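(* Let $A\in\mathbb{C}^{n\times N}$, let $S\subset\{1,\dots,N\}$ with $|S|=k$ such that $A_S$ has full column rank. Let $X\in\mathbb{R}^{N\times L}$ have all rows outside $S$ equal to zero and $X^S=\Sigma\Phi$, where $\Sigma\in\mathbb{R}^{k\times k}$ is a diagonal matrix with positive diagonal entries and $\Phi\in\mathbb{R}^{k\times L}$ has independent standard normal entries. Define $$A_L=\sqrt2\,\frac{\Gamma((L+1)/2)}{\Gamma(L/2)},\qquad \gamma=\frac{A_L}{3\sqrt L+2\sqrt k}.$$ If $\|A_S^\dagger a_\ell\|_2<\gamma$ for all $\ell\notin S$, then with probability at least $$1-\exp(-L/8)-k\exp(-A_L^2/8)$$ $X$ is the unique solution of $\min_Z\|Z\|_{2,1}$ subject to $AZ=AX$.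
   Context: $a_\ell$ is the $\ell$-th column of $A$, $A_S$ the submatrix of columns indexed by $S$, $A_S^\dagger=(A_S^*A_S)^{-1}A_S^*$. For $X\in\mathbb{C}^{N\times L}$, $X^j$ is its $j$-th row, $X^S$ the rows indexed by $S$, and $\|X\|_{2,1}=\sum_j\|X^j\|_2$. $\Gamma$ is the Gamma function. *)

(* Defs.v *)
From HB Require Import structures.
From mathcomp Require Import all_boot all_order all_algebra.
From mathcomp Require Import all_classical all_reals all_analysis.
From mathcomp Require Import complex.
Set Implicit Arguments. Unset Strict Implicit. Unset Printing Implicit Defensive.
Import Order.TTheory GRing.Theory Num.Theory.
Local Open Scope classical_set_scope.
Local Open Scope ring_scope.

Section Defs.
Variable R : realType.
Local Notation C := (R[i]).

Definition Gamma (s : R) : R :=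
  Rintegral lebesgue_measure `]0, +oo[%classic (fun t => powR t (s - 1) * expR (- t)).

Definition A_L (L : nat) : R :=
  Num.sqrt 2 * Gamma ((L%:R + 1) / 2) / Gamma (L%:R / 2).

Definition vnorm2 m (v : 'cV[C]_m) : R := Num.sqrt (\sum_i Normc.normc (v i 0) ^+ 2).

Definition rownorm2 m n (Z : 'M[C]_(m, n)) (r : 'I_m) : R :=
  Num.sqrt (\sum_j Normc.normc (Z r j) ^+ 2).

Definition norm21 m n (Z : 'M[C]_(m, n)) : R := \sum_r rownorm2 Z r.

Definition adjmx m n (M : 'M[C]_(m, n)) : 'M[C]_(n, m) := map_mx (@conjc R) M^T.

Definition colsS n N (A : 'M[C]_(n, N)) (S : {set 'I_N}) : 'M[C]_(n, #|S|) :=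
  \matrix_(i, j) A i (enum_val j).

(* Moore-Penrose pseudoinverse for full column rank: (A^* A)^-1 A^* *)
Definition pinvS n k (AS : 'M[C]_(n, k)) : 'M[C]_(k, n) :=
  invmx (adjmx AS *m AS) *m adjmx AS.

Definition l21_solution n N L (A : 'M[C]_(n, N)) (Y Z : 'M[C]_(N, L)) : Prop :=
  A *m Z = A *m Y /\ forall Z', A *m Z' = A *m Y -> norm21 Z <= norm21 Z'.

Definition unique_l21_solution n N L (A : 'M[C]_(n, N)) (X : 'M[C]_(N, L)) : Prop :=
  l21_solution A X X /\ forall Z, l21_solution A X Z -> Z = X.

End Defs.

Definition iid_std_normal_mx (R : realType) (d : measure_display) (T : measurableType d)
    (P : probability T R) k L (Phi : T -> 'M[R]_(k, L)) : Prop :=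
  [/\ (forall i j, measurable_fun setT (fun w => Phi w i j)),
      (forall i j (B : set R), measurable B ->
          P [set w | B (Phi w i j)] = normal_prob 0 1 B) &
      (forall B : 'I_k -> 'I_L -> set R, (forall i j, measurable (B i j)) ->
          P [set w | forall i j, B i j (Phi w i j)] =
          (\prod_(i < k) \prod_(j < L) P [set w | B i j (Phi w i j)])%E)].

(* Main.v *)
Require Import Defs.
From HB Require Import structures.
From mathcomp Require Import all_boot all_order all_algebra.
From mathcomp Require Import all_classical all_reals all_analysis.
From mathcomp Require Import measurable_realfun.
From mathcomp Require Import complex.
From mathcomp Require Import ring lra.
Import Order.TTheory GRing.Theory Num.Theory.
Import HBNNSimple numFieldNormedType.Exports.
Local Open Scope classical_set_scope.
Local Open Scope ring_scope.

(** A dual certificate reduces uniqueness to [|U^T v_l| < 1] for [l] outside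
    [S], where [v_l] is the pseudoinverse applied to the [l]-th column and [U]
    is [Phi] with normalized rows; [sigma] cancels.  Since [A_L^2 <= L]
    (AM-GM inside the Gamma integral), it suffices that every row of [Phi] has
    squared norm at least [4L/9] and that [|Phi| <= 2 sqrt L + (4/3) sqrt k].
    The former fails with probability at most [k exp(-L/8)] by a Chernoff
    bound.  The latter fails with probability at most [exp(-L/8)] by a
    PAC-Bayesian argument that replaces concentration of measure and Gordon's
    comparison theorem: average [exp(lam x^T Phi y - lam^2 |x|^2 |y|^2 / 2)],
    of expectation 1, over a prior on [(x, y)] and compare with posteriors
    having prescribed means.  The prior is the finite analogue of a Gaussian,
    a normalized sum of random signs, and the posteriors bias those signs, so
    that all averages over [(x, y)] are finite sums. *)

(** * Expectations of products of independent variables *)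

(** The hypothesis on [B] says that [nu] is the image under [phi] of the measure with density [G];
    monotone limits of simple functions carry this from indicators to every nonnegative measurable
    [f]. *)
Lemma ge0_integral_transfer (R : realType) (d1 d2 : measure_display)
    (X : measurableType d1) (Y : measurableType d2)
    (m : {measure set X -> \bar R}) (nu : {measure set Y -> \bar R})
    (phi : X -> Y) (G : X -> R) (f : Y -> R) :
  measurable_fun [set: X] phi -> measurable_fun [set: X] G ->
  (forall x, 0 <= G x) ->
  (forall B, measurable B -> (\int[m]_x (\1_B (phi x) * G x)%:E = nu B)%E) ->
  measurable_fun [set: Y] f -> (forall y, 0 <= f y) ->
  (\int[m]_x (f (phi x) * G x)%:E = \int[nu]_y (f y)%:E)%E.
Proof.
move=> mphi mG G0 GB mf f0.
have mEf : measurable_fun [set: Y] (EFin \o f) by exact/measurable_EFinP.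
pose g := nnsfun_approx measurableT mEf.
have nd_g y n1 n2 : (n1 <= n2)%N -> (g n1 y <= g n2 y)%R.
  by move=> n12; exact/lefP/nd_nnsfun_approx.
have cvg_g y : (g n y)%:E @[n --> \oo] --> (f y)%:E.
  by apply: (cvg_nnsfun_approx measurableT mEf) => // z _; rewrite lee_fin.
have mg n : measurable_fun [set: X] (fun x => g n (phi x)).
  by apply: (measurableT_comp _ mphi); exact: measurable_funP.
transitivity (limn (fun n => \int[m]_x (g n (phi x) * G x)%:E))%E.
  rewrite -monotone_convergence//=.
  - apply: eq_integral => x _; apply/esym/cvg_lim => //.
    under eq_fun do rewrite EFinM.
    by rewrite EFinM; apply: cvgeZr => //; exact: cvg_g.
  - by move=> n; apply/measurable_EFinP/measurable_funM.
  - by move=> n x _; rewrite lee_fin mulr_ge0.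
  - by move=> x _ n1 n2 n12; rewrite lee_fin ler_wpM2r// nd_g.
transitivity (limn (fun n => \int[nu]_y (g n y)%:E))%E; last first.
  rewrite -monotone_convergence//=.
  - by apply: eq_integral => x _; apply/cvg_lim => //; exact: cvg_g.
  - by move=> n; apply/measurable_EFinP; exact: measurable_funP.
  - by move=> n x _; rewrite lee_fin.
  - by move=> x _ n1 n2 n12; rewrite lee_fin nd_g.
congr (limn _); apply/funext => n.
transitivity (\sum_(k \in range (g n))
    (\int[m]_x (k * (\1_(g n @^-1` [set k]) (phi x) * G x))%:E))%E.
  under eq_integral do rewrite fimfunE fsbig_finite//= mulr_suml -sumEFin
    -fsbig_finite//=.
  rewrite ge0_integral_fsum//=.
  - by apply: eq_fsbigr => k _; under eq_integral do rewrite -mulrA.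
  - move=> k; apply/measurable_EFinP/measurable_funM => //.
    apply: measurable_funM => //; apply: measurableT_comp => //.
  - move=> k x _; rewrite lee_fin mulr_ge0//.
    have := nnfun_muleindic_ge0 (g n) k (phi x).
    by rewrite -EFinM lee_fin.
under [RHS]eq_integral do rewrite fimfunE -fsumEFin//.
rewrite ge0_integral_fsum//=; last 2 first.
- by move=> k; apply/measurable_EFinP/measurable_funM.
- by move=> k y _; rewrite nnfun_muleindic_ge0.
apply: eq_fsbigr => k /[!inE] -[y _ <-].
under eq_integral do rewrite EFinM.
under [RHS]eq_integral do rewrite EFinM.
have mk : measurable (g n @^-1` [set g n y]) by [].
rewrite !ge0_integralZl//=.
- by rewrite GB// integral_indic// setIT.
- exact/measurable_EFinP.
- by rewrite lee_fin.
- by apply/measurable_EFinP/measurable_funM => //; apply: measurableT_comp.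
- by move=> x _; rewrite lee_fin mulr_ge0.
- by rewrite lee_fin.
Qed.

Lemma ge0_integral_density (R : realType) (d : measure_display)
    (X : measurableType d) (m nu : {measure set X -> \bar R}) (h f : X -> R) :
  measurable_fun [set: X] h -> (forall x, 0 <= h x) ->
  (forall B, measurable B -> (\int[m]_(x in B) (h x)%:E = nu B)%E) ->
  measurable_fun [set: X] f -> (forall y, 0 <= f y) ->
  (\int[nu]_y (f y)%:E = \int[m]_x (f x * h x)%:E)%E.
Proof.
move=> mh h0 hB mf f0; apply/esym.
apply: (@ge0_integral_transfer R d d X X m nu id) => // B mB.
rewrite -hB// [RHS]integral_mkcond; apply: eq_integral => x _.
by rewrite patchE indicE; case: ifPn => _; rewrite ?mul1r ?mul0r.
Qed.

(** Induction on the number of factors that are not indicators. With indicators only, the claim is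
    independence itself; a general factor is reached by transferring the integral along its
    variable, the other factors serving as weight. *)
Lemma expectation_prod_independent (R : realType) (d e : measure_display)
    (T : measurableType d) (U : measurableType e) (P : probability T R)
    (nu : probability U R) (I : finType) (Y : I -> T -> U) (f : I -> U -> R) :
  (forall i, measurable_fun [set: T] (Y i)) ->
  (forall B : I -> set U, (forall i, measurable (B i)) ->
    P [set w | forall i, B i (Y i w)] = (\prod_i nu (B i))%E) ->
  (forall i, measurable_fun [set: U] (f i)) ->
  (forall i u, 0 <= f i u) ->
  (forall i, (\int[nu]_u (f i u)%:E < +oo)%E) ->
  (\int[P]_w (\prod_i f i (Y i w))%:E = \prod_i \int[nu]_u (f i u)%:E)%E.
Proof.
move=> mY indep.
(* [A] contains all indices whose factor may fail to be an indicator. *)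
suff main n (A : {set I}) (g : I -> U -> R) : #|A| = n ->
    (forall i, measurable_fun [set: U] (g i)) ->
    (forall i u, 0 <= g i u) ->
    (forall i, (\int[nu]_u (g i u)%:E < +oo)%E) ->
    (forall i, i \notin A -> exists2 B, measurable B & g i = \1_B) ->
    (\int[P]_w (\prod_i g i (Y i w))%:E = \prod_i \int[nu]_u (g i u)%:E)%E.
  move=> mf f0 fy; apply: (main #|[set: I]%SET| [set: I]%SET) => // i.
  by rewrite finset.in_setT.
elim: n A g => [|n IH] A g cA mg g0 gy gA.
  have /all_sig2[B mB gB] i : {B : set U | measurable B & g i = \1_B}.
    apply: cid2; apply: gA.
    by move/eqP: cA; rewrite cards_eq0 => /eqP ->; rewrite finset.in_set0.
  transitivity (P [set w | forall i, B i (Y i w)]).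
    rewrite -[in RHS](setIT [set w | _]) -integral_indic//; last first.
      rewrite (_ : [set w | _] = \bigcap_(i in [set: I]) (Y i @^-1` B i)).
        apply: fin_bigcap_measurable => // i _.
        by rewrite -[_ @^-1` _]setTI; exact: mY.
      by apply/seteqP; split=> w /= => [h i _|h i]; exact: h.
    apply: eq_integral => w _; congr (_%:E).
    under eq_bigr do rewrite gB.
    rewrite indicE; case: (asboolP (forall i, B i (Y i w))) => h.
      rewrite big1 ?mem_set// => i _.
      by rewrite indicE mem_set.
    rewrite memNset//.
    have [i nB] : exists i, ~ B i (Y i w) by exact/existsNP.
    by rewrite (bigD1 i)//= indicE memNset// mul0r.
  rewrite indep//; apply: eq_bigr => i _.
  by rewrite gB integral_indic// setIT.
have [i iA] : exists i, i \in A.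
  by apply/set0Pn; rewrite -cards_eq0 cA.
have fin_int j : (\int[nu]_u (g j u)%:E)%E \is a fin_num.
  by rewrite ge0_fin_numE// integral_ge0// => u _; rewrite lee_fin.
pose c := \prod_(j | j != i) fine (\int[nu]_u (g j u)%:E)%E.
have c0 : 0 <= c.
  by apply: prodr_ge0 => j _; rewrite fine_ge0// integral_ge0// => u _; rewrite lee_fin.
have cE : (\prod_(j | j != i) \int[nu]_u (g j u)%:E)%E = c%:E.
  by rewrite /c -prodEFin; apply: eq_bigr => j _; rewrite fineK.
pose G w := \prod_(j | j != i) g j (Y j w).
have mG : measurable_fun [set: T] G.
  rewrite /G; under eq_fun do rewrite -big_filter.
  by apply: measurable_prod => j _; exact: measurableT_comp (mg j) (mY j).
rewrite (bigD1 i)//= cE muleC.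
under eq_integral do rewrite (bigD1 i)//=.
(* Absorbing the constant into the measure turns the goal into a transfer from [P] weighted by [G]
   to [c] times [nu]; for an indicator in place [i] this is the induction hypothesis for [A] without
   [i]. *)
rewrite -[c]/(NngNum c0)%:num -ge0_integral_mscale//; last 2 first.
- exact/measurable_EFinP.
- by move=> u _; rewrite lee_fin.
apply: (@ge0_integral_transfer R d e T U P (mscale (NngNum c0) nu) (Y i) G) => //.
- by move=> w; apply: prodr_ge0 => j _.
move=> B mB.
pose g' j := if j == i then \1_B else g j.
have int_indic : (\int[nu]_u (\1_B u)%:E = nu B)%E by rewrite integral_indic// setIT.
transitivity (\int[P]_w (\prod_j g' j (Y j w))%:E)%E.
  apply: eq_integral => w _; rewrite [in RHS](bigD1 i)//= /g' eqxx.
  congr ((_ * _)%:E); apply: eq_bigr => j /negbTE ->//.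
rewrite (IH (A :\ i)%SET).
- rewrite (bigD1 i)//= /mscale/= -cE {1}/g' eqxx int_indic muleC.
  by congr (_ * _)%E; apply: eq_bigr => j /negbTE ji; rewrite /g' ji.
- by move: cA; rewrite (cardsD1 i) iA => -[].
- by move=> j; rewrite /g'; case: ifP.
- by move=> j u; rewrite /g'; case: ifP.
- move=> j; rewrite /g'; case: ifP => // _.
  by rewrite int_indic (le_lt_trans (probability_le1 _ _))// ltry.
- move=> j; rewrite !inE negb_and negbK /g'; case: eqP => [_ _|_ /= jA].
    by exists B.
  exact: gA.
Qed.

(** * Integrals against the standard normal law *)

Lemma integral_std_normal (R : realType) (f : R -> R) :
  measurable_fun [set: R] f -> (forall x, 0 <= f x) ->
  (\int[normal_prob 0 1]_x (f x)%:E =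
   \int[lebesgue_measure]_x (f x * normal_pdf 0 1 x)%:E)%E.
Proof.
move=> mf f0; apply: ge0_integral_density => //.
- exact: measurable_normal_pdf.
- by move=> x; exact: normal_pdf_ge0.
Qed.

(** Completing the square produces the normal density of mean [c] and variance 1. *)
Lemma std_normal_mgf (R : realType) (c : R) :
  (\int[normal_prob 0 1]_x (expR (c * x))%:E = (expR (c ^+ 2 / 2))%:E)%E.
Proof.
rewrite integral_std_normal//; last first.
  by apply: measurableT_comp => //; exact: measurable_funM.
transitivity (\int[lebesgue_measure]_x
    ((expR (c ^+ 2 / 2))%:E * (normal_pdf c 1 x)%:E))%E.
  apply: eq_integral => x _; rewrite -EFinM !normal_pdfE//.
  rewrite mulrCA [in RHS]mulrCA /normal_fun -!expRD; congr (_ * expR _)%:E.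
  by field.
rewrite ge0_integralZl//=.
- by rewrite integral_normal_pdf mule1.
- by apply/measurable_EFinP; exact: measurable_normal_pdf.
- by move=> x _; rewrite lee_fin normal_pdf_ge0.
Qed.

(** The integrand times the standard density is [s] times the centred normal density of standard
    deviation [s]. Taking [s] as the parameter keeps square roots out of the Chernoff bound. *)
Lemma std_normal_sqr_laplace (R : realType) (s : R) : 0 < s ->
  (\int[normal_prob 0 1]_x (expR (- ((s ^- 2 - 1) / 2 * x ^+ 2)))%:E = s%:E)%E.
Proof.
move=> s0; rewrite integral_std_normal//; last first.
  apply: measurableT_comp => //; apply: measurableT_comp => //.
  by apply: measurable_funM => //; exact: measurable_funX.
have s_neq0 : s != 0 by rewrite gt_eqF.
transitivity (\int[lebesgue_measure]_x (s%:E * (normal_pdf 0 s x)%:E))%E.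
  apply: eq_integral => x _; rewrite -EFinM !normal_pdfE//.
  rewrite /normal_peak -!mulrnAr (sqrtrM _ (sqr_ge0 s)) sqrtr_sqr gtr0_norm//.
  rewrite [in RHS]invfM -(mulrA s^-1) mulVKf// /normal_fun.
  rewrite mulrCA -expRD expr1n mul1r; congr (_ * expR _)%:E.
  by field.
rewrite ge0_integralZl//=.
- by rewrite integral_normal_pdf mule1.
- by apply/measurable_EFinP; exact: measurable_normal_pdf.
- by move=> x _; rewrite lee_fin normal_pdf_ge0.
- by rewrite lee_fin ltW.
Qed.

(** * Lower tail of the row norms *)

Lemma iid_std_normal_prod (R : realType) (d : measure_display)
    (T : measurableType d) (P : probability T R) (k L : nat)
    (Phi : T -> 'M[R]_(k, L)) (f : 'I_k -> 'I_L -> R -> R) :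
  iid_std_normal_mx P Phi ->
  (forall i j, measurable_fun [set: R] (f i j)) ->
  (forall i j x, 0 <= f i j x) ->
  (forall i j, (\int[normal_prob 0 1]_x (f i j x)%:E < +oo)%E) ->
  (\int[P]_w (\prod_i \prod_j f i j (Phi w i j))%:E =
   \prod_i \prod_j \int[normal_prob 0 1]_x (f i j x)%:E)%E.
Proof.
move=> [mPhi lawPhi indep] mf f0 fy.
under eq_integral do rewrite pair_big/=.
rewrite pair_big/=.
apply: (@expectation_prod_independent R d _ T (measurableTypeR R) P
  (normal_prob 0 1) _ (fun p w => Phi w p.1 p.2) (fun p => f p.1 p.2)) => //=.
- by move=> p; exact: mPhi.
- move=> B mB.
  transitivity (P [set w | forall i j, B (i, j) (Phi w i j)]).
    congr (P _); apply/seteqP; split=> w /= h => [i j|[i j]]; first exact: (h (i, j)).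
    exact: h.
  rewrite (indep (fun i j => B (i, j)))//; last by move=> i j; exact: mB.
  rewrite (pair_bigA _ (fun i j => P [set w | B (i, j) (Phi w i j)]))/=.
  by apply: eq_bigr => -[i j] _; rewrite lawPhi//; exact: mB.
- by move=> p; exact: mf.
Qed.

Lemma markov_ge0 (R : realType) (d : measure_display) (T : measurableType d)
    (P : probability T R) (Z : T -> R) (c : R) :
  measurable_fun [set: T] Z -> (forall w, 0 <= Z w) -> 0 < c ->
  (c%:E * P [set w | (c <= Z w)%R] <= \int[P]_w (Z w)%:E)%E.
Proof.
move=> mZ Z0 c0.
have mEZ : measurable_fun [set: T] (EFin \o Z) by exact/measurable_EFinP.
have := le_integral_abse P measurableT mEZ c0; rewrite setTI.
under [in X in (_ <= X)%E]eq_integral do rewrite /= ger0_norm//.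
congr (_ * P _ <= _)%E; apply/seteqP.
by split=> w /=; rewrite ger0_norm// lee_fin.
Qed.

Lemma measurable_superlevel (R : realType) (d : measure_display)
    (T : measurableType d) (Z : T -> R) (c : R) :
  measurable_fun [set: T] Z -> measurable [set w | c <= Z w].
Proof.
move=> mZ; rewrite (_ : [set w | _] = Z @^-1` `[c, +oo[%classic).
  by rewrite -[_ @^-1` _]setTI; exact: mZ.
by apply/seteqP; split=> w /=; rewrite in_itv/= andbT.
Qed.

(* 29/72 = 5/18 + 1/8 is the exponent left by the Chernoff bound below;
   ln (3/2) exceeds it by less than 0.003. *)
Lemma expR_29_72 (R : realType) : expR (29 / 72) <= 3 / 2 :> R.
Proof.
have square (a b t : R) : 0 <= a -> 0 <= b -> b <= a ^+ 2 ->
    a <= expR (- t) -> b <= expR (- (2 * t)).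
  move=> a0 b0 ba aet; apply: (le_trans ba).
  rewrite (_ : - (2 * t) = - t + - t); last by ring.
  by rewrite expRD -expr2 lerXn2r// nnegrE expR_ge0.
(* Start from [1 - t <= expR (- t)] with [t] equal to 29/72 divided by 32, and square five times,
   rounding down to a short fraction each time. *)
have [t tE] : exists t : R, t = 29 / 2304 by exists (29 / 2304).
have h0 : 2275 / 2304 <= expR (- t).
  by apply: le_trans (expR_ge1Dx _); lra.
have {}h0 : 1598 / 1639 <= expR (- (2 * t)).
  apply: (square _ _ t _ _ _ h0); lra.
have {}h0 : 1597 / 1680 <= expR (- (2 * (2 * t))).
  apply: (square _ _ (2 * t) _ _ _ h0); lra.
have {}h0 : 647 / 716 <= expR (- (2 * (2 * (2 * t)))).
  apply: (square _ _ (2 * (2 * t)) _ _ _ h0); lra.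
have {}h0 : 2319 / 2840 <= expR (- (2 * (2 * (2 * (2 * t))))).
  apply: (square _ _ (2 * (2 * (2 * t))) _ _ _ h0); lra.
have {}h0 : 2 / 3 <= expR (- (2 * (2 * (2 * (2 * (2 * t)))))).
  apply: (square _ _ (2 * (2 * (2 * (2 * t)))) _ _ _ h0); lra.
have -> : 3 / 2 = (2 / 3)^-1 :> R by field.
have -> : 29 / 72 = - - (29 / 72) :> R by rewrite opprK.
rewrite expRN lef_pV2 ?posrE ?expR_gt0//.
have <- : 2 * (2 * (2 * (2 * (2 * t)))) = 29 / 72 by lra.
by apply: le_trans h0; lra.
Qed.

(** Chernoff bound: [Z] below has expectation [(2 / 3) ^+ L], and Markov's inequality leaves
    [(2 / 3 * expR (5 / 18)) ^+ L], which is at most [expR (- (L%:R / 8))]. *)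
Lemma row_norm_tail (R : realType) (d : measure_display)
    (T : measurableType d) (P : probability T R) (k L : nat)
    (Phi : T -> 'M[R]_(k, L)) (i : 'I_k) : iid_std_normal_mx P Phi ->
  let E := [set w | 4 / 9 * L%:R <= \sum_j Phi w i j ^+ 2] in
  measurable E /\ (P (~` E) <= (expR (- (L%:R / 8)))%:E)%E.
Proof.
move=> iid E; have [mPhi _ _] := iid.
have mS : measurable_fun [set: T] (fun w => \sum_j Phi w i j ^+ 2).
  by apply: measurable_sum => j; exact: measurable_funX.
have mE : measurable E by exact: measurable_superlevel.
split=> //.
(* 5/8 is the optimal Chernoff parameter for the threshold 4/9. *)
pose Z w := expR (- (5 / 8 * \sum_j Phi w i j ^+ 2)).
have mZ : measurable_fun [set: T] Z.
  by apply: measurableT_comp => //; apply: measurableT_comp => //; exact: measurable_funM.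
have c58 : ((2 / 3) ^- 2 - 1) / 2 = 5 / 8 :> R by rewrite expr2; field.
have EZ : (\int[P]_w (Z w)%:E = ((2 / 3) ^+ L)%:E)%E.
  (* Factors equal to 1 outside row [i] let the product formula for the whole matrix apply to a
     single row. *)
  pose f (i' : 'I_k) (j : 'I_L) x : R :=
    if i' == i then expR (- (((2 / 3) ^- 2 - 1) / 2 * x ^+ 2)) else 1.
  have mf i' j : measurable_fun [set: R] (f i' j).
    rewrite /f; case: (i' == i) => //.
    apply: measurableT_comp => //; apply: measurableT_comp => //.
    by apply: measurable_funM => //; exact: measurable_funX.
  have intf i' j : (\int[normal_prob 0 1]_x (f i' j x)%:E =
      (if i' == i then 2 / 3 else 1)%:E)%E.
    rewrite /f; case: (i' == i); first by rewrite std_normal_sqr_laplace//; lra.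
    by rewrite integral_cst//= probability_setT mule1.
  have h := iid_std_normal_prod R d T P k L Phi f iid mf.
  transitivity (\int[P]_w (\prod_i' \prod_j f i' j (Phi w i' j))%:E)%E.
    apply: eq_integral => w _; congr (_%:E).
    rewrite (bigD1 i)//= [X in _ * X]big1 ?mulr1; last first.
      by move=> i' /negbTE ii; apply: big1 => j _; rewrite /f ii.
    rewrite /Z mulr_sumr -sumrN expR_sum; apply: eq_bigr => j _.
    by rewrite /f eqxx c58.
  rewrite h.
  - rewrite (bigD1 i)//= [X in (_ * X)%E]big1 ?mule1; last first.
      by move=> i' /negbTE ii; apply: big1 => j _; rewrite intf ii.
    under eq_bigr do rewrite intf eqxx.
    by rewrite prodEFin prodr_const card_ord.
  - by move=> i' j x; rewrite /f; case: ifP => // _; exact: expR_ge0.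
  - by move=> i' j; rewrite intf ltry.
have := markov_ge0 R d T P Z _ mZ (fun w => expR_ge0 _) (expR_gt0 (- (5 / 18 * L%:R))).
rewrite EZ => hM.
(* Off [E] the sum is below [4 / 9 * L%:R], and [5 / 8 * (4 / 9) = 5 / 18]. *)
have PE : (P (~` E) <= P [set w | (expR (- (5 / 18 * L%:R)) <= Z w)%R])%E.
  apply: le_measure; rewrite ?inE//; first exact: measurableC.
    exact: measurable_superlevel.
  move=> w /= /negP; rewrite -ltNge => h; rewrite ler_expR lerN2.
  by move: h; set s := \sum_j _ => h; lra.
apply: (le_trans PE).
rewrite -(@lee_pmul2l _ (expR (- (5 / 18 * L%:R)))%:E)//.
apply: (le_trans hM); rewrite -EFinM lee_fin -expRD.
rewrite (_ : _ - _ = L%:R * - (29 / 72)); last by field.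
rewrite expRM_natl lerXn2r// ?nnegrE ?expR_ge0//.
rewrite (_ : 2 / 3 = (3 / 2)^-1); last by field.
by rewrite expRN lef_pV2 ?posrE ?expR_gt0// expR_29_72.
Qed.

(** * Smoothing by tilted random signs *)

(* The coefficient 1/2 is not attainable; 9/20 makes the entropy of a tilted
   sign 11/20 u^2 instead of the Gaussian u^2 / 2. *)
Lemma add1_le_expR_quadratic (R : realType) (z : R) : `|z| <= 10^-1 ->
  1 + z <= expR (z - 9 / 20 * z ^+ 2).
Proof.
rewrite ler_norml => /andP[z1 z2].
(* The claim amounts to [f 1 <= f (1 + z)]. The derivative of [f] has the sign of
   [(s - 1) * (1 - 9 / 10 * s)], so 1 is a minimum among positive [s] below 10/9, a range that the
   bound on [z] guarantees. *)
pose g : R -> R := (@id R : R -> R) - cst 1.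
pose f : R -> R := g - cst (9 / 20) * g ^+ 2 - (@ln R : R -> R).
pose df (s : R) := 1 - 9 / 10 * (s - 1) - s^-1.
have df_f (s : R) : 0 < s -> is_derive s 1 f (df s).
  move=> s0; have dln : is_derive s 1 (@ln R) s^-1 by exact: is_derive1_ln.
  have dg : is_derive s 1 g 1 by apply: is_derive_eq; rewrite subr0.
  apply: is_derive_eq; rewrite /df /GRing.scale/= /g !fctE/=; field.
  by rewrite gt_eqF.
have cf (a b : R) : 0 < a -> {within `[a, b], continuous f}.
  move=> a0; apply: derivable_within_continuous => s; rewrite in_itv/= => /andP[a_s _].
  by have [] := df_f s (lt_le_trans a0 a_s).
have fE s : f s = s - 1 - 9 / 20 * (s - 1) ^+ 2 - ln s by [].
have dfE s : 0 < s -> df s * s = (s - 1) * (1 - 9 / 10 * s).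
  by move=> s0; rewrite /df; field; rewrite gt_eqF.
have key : f 1 <= f (1 + z).
  have [z0|z0] := leP 0 z.
    have [|||c] := @MVT_segment R f df 1 (1 + z).
    - lra.
    - by move=> s; rewrite in_itv/= => /andP[s1 _]; apply: df_f; lra.
    - by apply: cf; lra.
    - rewrite in_itv/= => /andP[c1 c2] E; rewrite -subr_ge0 E.
    have c0 : 0 < c by lra.
    rewrite mulr_ge0//; last lra.
    by rewrite -(pmulr_lge0 _ c0) dfE// mulr_ge0//; lra.
  have [|||c] := @MVT_segment R f df (1 + z) 1.
  - lra.
  - by move=> s; rewrite in_itv/= => /andP[s1 _]; apply: df_f; lra.
  - by apply: cf; lra.
  rewrite in_itv/= => /andP[c1 c2] E; rewrite -subr_le0 E.
  have c0 : 0 < c by lra.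
  rewrite mulr_le0_ge0//; last lra.
  by rewrite -(pmulr_lle0 _ c0) dfE// mulr_le0_ge0//; lra.
move: key; rewrite !fE ln1 => key.
rewrite -[X in X <= _]lnK ?posrE; last lra.
by rewrite ler_expR; move: key; rewrite subrr expr0n/= [1 + z - 1]addrAC subrr add0r; lra.
Qed.

(** Discrete Gibbs variational inequality, with [h] an upper bound of the log-density of [p] with
    respect to [pi]. It follows from the tangent line of [expR] at the [p]-mean [m] of [f - h]. *)
Lemma jensen_change_of_measure (R : realType) (K : finType) (p pi f h : K -> R) :
  (forall e, 0 <= p e) -> \sum_e p e = 1 -> (forall e, p e <= pi e * expR (h e)) ->
  expR (\sum_e p e * (f e - h e)) <= \sum_e pi e * expR (f e).
Proof.
move=> p0 p1 ppi; set m := \sum_e _.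
have -> : expR m = \sum_e p e * (expR m * (1 + (f e - h e - m))).
  under eq_bigr do rewrite mulrCA.
  rewrite -mulr_sumr; under eq_bigr do rewrite addrA mulrBr mulrDr mulr1.
  rewrite big_split/= big_split/= sumrN -mulr_suml p1 -/m.
  by rewrite mul1r addrK mulr1.
apply: ler_sum => e _.
apply: (@le_trans _ _ (p e * expR (f e - h e))).
  apply: ler_wpM2l => //.
  have -> : expR (f e - h e) = expR m * expR (f e - h e - m).
    by rewrite -expRD; congr expR; ring.
  by rewrite ler_wpM2l ?expR_ge0// expR_ge1Dx.
apply: (le_trans (ler_wpM2r (expR_ge0 _) (ppi e))).
by rewrite -mulrA -expRD subrKC.
Qed.

(** Law of independent random signs with means [u j], where [true] stands for the sign -1; [u = 0]
    gives uniform signs. *)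
Definition tilt (R : realType) (J : finType) (u : J -> R) (e : {ffun J -> bool}) : R :=
  \prod_j ((1 + u j * (-1) ^+ (e j)) / 2).

Lemma tilt_ge0 (R : realType) (J : finType) (u : J -> R) e :
  (forall j, `|u j| <= 1) -> 0 <= tilt R J u e.
Proof.
move=> u1; apply: prodr_ge0 => j _; have := u1 j; rewrite ler_norml => /andP[? ?].
by case: (e j); rewrite ?expr1 ?expr0; lra.
Qed.

(** Independence of the signs: total mass, means and second moments all come from this formula with
    a suitable [g]. *)
Lemma sum_tilt_prod (R : realType) (J : finType) (u : J -> R) (g : J -> bool -> R) :
  \sum_e tilt R J u e * \prod_j g j (e j) =
  \prod_j ((1 - u j) / 2 * g j true + (1 + u j) / 2 * g j false).
Proof.
transitivity (\prod_j \sum_(b : bool) (1 + u j * (-1) ^+ b) / 2 * g j b).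
  by rewrite bigA_distr_bigA; apply: eq_bigr => e _; rewrite -big_split.
by apply: eq_bigr => j _; rewrite big_bool/= expr0 expr1 mulrN1 mulr1.
Qed.

Lemma sum_tilt (R : realType) (J : finType) (u : J -> R) : \sum_e tilt R J u e = 1.
Proof.
transitivity (\sum_e tilt R J u e * \prod_(j : J) (1 : R)).
  by apply: eq_bigr => e _; rewrite big1_eq mulr1.
by rewrite (sum_tilt_prod R J u (fun _ _ => 1)); apply: big1 => j _; field.
Qed.

Lemma sum_tilt_sign (R : realType) (J : finType) (u : J -> R) (i : J) :
  \sum_e tilt R J u e * (-1) ^+ (e i) = u i.
Proof.
have prod1 (F : J -> R) : \prod_j (if j == i then F j else 1) = F i.
  by rewrite -big_mkcond big_pred1_eq.
transitivity (\sum_e tilt R J u e * \prod_j (if j == i then (-1) ^+ (e j) else 1)).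
  by apply: eq_bigr => e _; rewrite prod1.
rewrite (sum_tilt_prod R J u (fun j b => if j == i then (-1) ^+ b else 1)).
rewrite -[RHS](prod1 u); apply: eq_bigr => j _.
by case: eqP => _; rewrite ?expr1 ?expr0; field.
Qed.

Lemma sum_tilt_sign2 (R : realType) (J : finType) (u : J -> R) (i i' : J) :
  \sum_e tilt R J u e * ((-1) ^+ (e i) * (-1) ^+ (e i')) =
  if i == i' then 1 else u i * u i'.
Proof.
have [->|ii'] := eqVneq i i'.
  under eq_bigr do rewrite -expr2 sqrr_sign mulr1.
  exact: sum_tilt.
have prod1 l (F : J -> R) : \prod_j (if j == l then F j else 1) = F l.
  by rewrite -big_mkcond big_pred1_eq.
transitivity (\sum_e tilt R J u e * \prod_j
    ((if j == i then (-1) ^+ (e j) else 1) * (if j == i' then (-1) ^+ (e j) else 1))).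
  by apply: eq_bigr => e _; rewrite big_split/= !prod1.
rewrite (sum_tilt_prod R J u (fun j b => (if j == i then (-1) ^+ b else 1) *
  (if j == i' then (-1) ^+ b else 1))).
rewrite -[X in _ = X * _](prod1 i u) -[X in _ = _ * X](prod1 i' u).
rewrite -big_split/=; apply: eq_bigr => j _.
have [->|ji] := eqVneq j i; first by rewrite (negbTE ii') expr1 expr0; field.
by case: eqP => _; rewrite ?expr1 ?expr0; field.
Qed.

Lemma tilt_le (R : realType) (J : finType) (u : J -> R) (e : {ffun J -> bool}) :
  (forall j, `|u j| <= 10^-1) ->
  tilt R J u e <= tilt R J (fun=> 0) e *
    expR (\sum_j (u j * (-1) ^+ (e j) - 9 / 20 * u j ^+ 2)).
Proof.
move=> u1; rewrite expR_sum -big_split/=; apply: ler_prod => j _.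
have z1 : `|u j * (-1) ^+ e j| <= 10^-1.
  by rewrite normrM normrX normrN1 expr1n mulr1.
have := add1_le_expR_quadratic R _ z1.
rewrite exprMn sqrr_sign mulr1 mul0r addr0 => h.
move: z1; rewrite ler_norml => /andP[z1 z2].
by apply/andP; split; lra.
Qed.

(* [pi] plays the role of the Gaussian prior N(0, q I) on R^k, [p] of the
   posterior N(x, q I), and [h] dominates the log-likelihood ratio. *)
Lemma smoothing (R : realType) (k : nat) (q : R) : 0 < q ->
  exists (K : finType) (pi : K -> R) (X : K -> 'I_k -> R),
  [/\ forall e, 0 <= pi e, \sum_e pi e = 1 &
   forall x : 'I_k -> R, \sum_i x i ^+ 2 <= 1 -> exists p h : K -> R,
   [/\ (forall e, 0 <= p e) /\ \sum_e p e = 1,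
       forall e, p e <= pi e * expR (h e),
       forall i, \sum_e p e * X e i = x i,
       \sum_e p e * (\sum_i X e i ^+ 2) <= 1 + k%:R * q &
       \sum_e p e * h e <= 11 / 20 / q]].
Proof.
move=> q0.
(* Using [m] signs per coordinate with [m%:R * q] at least 100 keeps each bias [u j] in the range of
   [tilt_le]. The scale [tau] gives a sum of [m] uniform signs the variance [q]. *)
pose m := (Num.truncn (100 / q)).+1.
have m0 : 0 < m%:R :> R by rewrite ltr0n.
have mq : 100 <= m%:R * q.
  by rewrite -ler_pdivrMr// ltW// truncnS_gt.
pose tau := Num.sqrt (q / m%:R).
have tau2 : tau ^+ 2 = q / m%:R by rewrite sqr_sqrtr// divr_ge0// ltW.
have tau0 : 0 < tau by rewrite sqrtr_gt0 divr_gt0.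
pose J : finType := ('I_k * 'I_m)%type.
exists {ffun J -> bool}, (tilt R J (fun=> 0)),
  (fun (e : {ffun J -> bool}) (i : 'I_k) => tau * \sum_(a < m) (-1) ^+ (e (i, a))); split.
- by move=> e; apply: tilt_ge0 => j; rewrite normr0.
- exact: sum_tilt.
move=> x x1.
(* The bias for which [tau] times the sum of [m] signs has mean [x i]. *)
pose u (j : J) := x j.1 / (m%:R * tau).
have u2 j : u j ^+ 2 = x j.1 ^+ 2 / (m%:R * q).
  by rewrite /u exprMn exprVn exprMn tau2; field; rewrite !gt_eqF.
have u1 j : `|u j| <= 10^-1.
  rewrite -ler_sqr ?nnegrE// real_normK ?num_real// u2.
  rewrite ler_pdivrMr; last by rewrite mulr_gt0.
  have xj1 : x j.1 ^+ 2 <= 1.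
    apply: le_trans x1; rewrite (bigD1 j.1)//= lerDl.
    by apply: sumr_ge0 => i _; exact: sqr_ge0.
  by rewrite expr2; lra.
exists (tilt R J u), (fun e : {ffun J -> bool} =>
  \sum_j (u j * (-1) ^+ (e j) - 9 / 20 * u j ^+ 2)); split.
- split; last exact: sum_tilt.
  by move=> e; apply: tilt_ge0 => j; apply: le_trans (u1 j) _; lra.
- by move=> e; exact: tilt_le.
- move=> i; under eq_bigr do rewrite mulrCA mulr_sumr.
  rewrite -mulr_sumr exchange_big/=.
  under eq_bigr do rewrite sum_tilt_sign.
  rewrite /u/= sumr_const card_ord -mulr_natr; field.
  by rewrite !gt_eqF.
- have second i : \sum_e tilt R J u e * (tau * \sum_(a < m) (-1) ^+ (e (i, a))) ^+ 2
      <= x i ^+ 2 + q.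
    under eq_bigr do rewrite exprMn mulrCA expr2 [X in _ * (_ * X)]big_distrlr/=.
    under eq_bigr do rewrite [X in _ * X]mulr_sumr.
    rewrite -mulr_sumr exchange_big/=.
    under eq_bigr => a _.
      under eq_bigr do rewrite mulr_sumr.
      rewrite exchange_big/=.
      under eq_bigr do rewrite sum_tilt_sign2.
      over.
    (* Pairs of distinct signs contribute the squared bias and equal ones contribute 1; adding the
       squared bias to the latter as well makes the sum explicit. *)
    apply: (@le_trans _ _ (tau ^+ 2 * \sum_(a < m) \sum_(b < m)
        (x i ^+ 2 / (m%:R * q) + (a == b)%:R))).
      rewrite ler_wpM2l ?sqr_ge0//; apply: ler_sum => a _; apply: ler_sum => b _.
      have ux a' : u (i, a') ^+ 2 = x i ^+ 2 / (m%:R * q) by rewrite u2.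
      rewrite -(ux a) xpair_eqE eqxx/=; case: eqP => _.
        by rewrite lerDr sqr_ge0.
      by rewrite addr0 expr2.
    under eq_bigr => a _.
      rewrite big_split/= sumr_const card_ord (bigD1 a)//= eqxx big1 ?addr0; last first.
        by move=> b /negbTE ba; rewrite eq_sym ba.
      over.
    rewrite big_split/= !sumr_const card_ord tau2.
    by rewrite le_eqVlt; apply/orP; left; apply/eqP; field; rewrite !gt_eqF.
  under eq_bigr do rewrite mulr_sumr.
  rewrite exchange_big/=.
  apply: (@le_trans _ _ (\sum_(i < k) (x i ^+ 2 + q))); first exact: ler_sum.
  by rewrite big_split/= sumr_const card_ord [X in _ <= _ + X]mulr_natl lerD2r.
(* The mean of [u j] times its sign is [u j ^+ 2], so each sign costs [(1 - 9 / 20) * u j ^+ 2]; the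
   [m] signs of coordinate [i] cost [11 / 20 / q * x i ^+ 2] together. *)
- under eq_bigr do rewrite mulr_sumr.
  rewrite exchange_big/=.
  under eq_bigr => j _.
    under eq_bigr do rewrite mulrBr mulrCA.
    rewrite big_split/= -mulr_sumr sum_tilt_sign sumrN -mulr_suml sum_tilt mul1r.
    rewrite -expr2 u2.
    over.
  rewrite -(pair_bigA _ (fun i (a : 'I_m) => x i ^+ 2 / (m%:R * q) -
    9 / 20 * (x i ^+ 2 / (m%:R * q))))/=.
  under eq_bigr do rewrite sumr_const card_ord.
  apply: (@le_trans _ _ (\sum_(i < k) (11 / 20 / q * x i ^+ 2))).
    apply: ler_sum => i _; rewrite le_eqVlt; apply/orP; left; apply/eqP; field.
    by rewrite !gt_eqF.
  rewrite -mulr_sumr -[X in _ <= X]mulr1 ler_wpM2l//.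
  by rewrite divr_ge0// ?ltW//; lra.
Qed.

(** * Upper tail of the operator norm *)

Lemma sum_pair_mul (R : realType) (K1 K2 : finType) (A : K1 -> R) (B : K2 -> R) :
  \sum_(e : K1 * K2) A e.1 * B e.2 = (\sum_e A e) * (\sum_e B e).
Proof. by rewrite big_distrlr/= pair_bigA. Qed.

Lemma std_normal_expR_martingale (R : realType) (a : R) :
  (\int[normal_prob 0 1]_x (expR (a * x - a ^+ 2 / 2))%:E = 1)%E.
Proof.
under eq_integral do rewrite expRD EFinM muleC.
rewrite ge0_integralZl//=.
- by rewrite std_normal_mgf -EFinM -expRD addNr expR0.
- apply/measurable_EFinP; apply: measurableT_comp => //; exact: measurable_funM.
Qed.

Lemma bilinear_form_tail (R : realType) (d : measure_display)
    (T : measurableType d) (P : probability T R) (k L : nat)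
    (Phi : T -> 'M[R]_(k, L)) (q1 q2 lam t : R) :
  iid_std_normal_mx P Phi -> 0 < q1 -> 0 < q2 ->
  exists G : set T, [/\ measurable G, (P (~` G) <= (expR (- t))%:E)%E &
    forall w, G w -> forall (x : 'I_k -> R) (y : 'I_L -> R),
      \sum_i x i ^+ 2 <= 1 -> \sum_j y j ^+ 2 <= 1 ->
      lam * (\sum_i \sum_j x i * Phi w i j * y j) <=
      lam ^+ 2 / 2 * ((1 + k%:R * q1) * (1 + L%:R * q2)) +
      11 / 20 / q1 + 11 / 20 / q2 + t].
Proof.
move=> iid q10 q20; have [mPhi _ _] := iid.
have [K1 [pi1 [X1 [pi1_ge0 pi1_sum smooth1]]]] := smoothing R k q1 q10.
have [K2 [pi2 [X2 [pi2_ge0 pi2_sum smooth2]]]] := smoothing R L q2 q20.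
pose a (e : K1 * K2) i j := lam * (X1 e.1 i * X2 e.2 j).
pose f w e := \sum_i \sum_j (a e i j * Phi w i j - a e i j ^+ 2 / 2).
pose pi (e : K1 * K2) := pi1 e.1 * pi2 e.2.
pose F w := \sum_e pi e * expR (f w e).
have pi_ge0 e : 0 <= pi e by rewrite mulr_ge0.
have mf e : measurable_fun [set: T] (fun w => expR (f w e)).
  apply: measurableT_comp => //; apply: measurable_sum => i.
  by apply: measurable_sum => j; apply: measurable_funB => //; exact: measurable_funM.
have mF : measurable_fun [set: T] F.
  by apply: measurable_sum => e; exact: measurable_funM.
have F_ge0 w : 0 <= F w by apply: sumr_ge0 => e _; rewrite mulr_ge0 ?expR_ge0.
have int_f e : (\int[P]_w (expR (f w e))%:E = 1)%E.
  transitivity (\int[P]_w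
      (\prod_i \prod_j expR (a e i j * Phi w i j - a e i j ^+ 2 / 2))%:E)%E.
    apply: eq_integral => w _; rewrite expR_sum.
    by congr (_%:E); apply: eq_bigr => i _; rewrite expR_sum.
  rewrite (iid_std_normal_prod R d T P k L Phi
    (fun i j x => expR (a e i j * x - a e i j ^+ 2 / 2)))//.
  - by apply: big1 => i _; apply: big1 => j _; exact: std_normal_expR_martingale.
  - move=> i j; apply: measurableT_comp => //; exact: measurable_funB.
  - by move=> i j; rewrite std_normal_expR_martingale ltry.
have int_F : (\int[P]_w (F w)%:E = 1)%E.
  under eq_integral do rewrite -sumEFin.
  rewrite ge0_integral_sum//=; last 2 first.
  - by move=> e; apply/measurable_EFinP; exact: measurable_funM.
  - by move=> e w _; rewrite lee_fin mulr_ge0 ?expR_ge0.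
  under eq_bigr => e _.
    under eq_integral do rewrite EFinM.
    rewrite ge0_integralZl//=; [|exact/measurable_EFinP|exact: pi_ge0].
    rewrite int_f mule1.
    over.
  by rewrite sumEFin (sum_pair_mul R K1 K2 pi1 pi2) pi1_sum pi2_sum mulr1.
exists (~` [set w | expR t <= F w]); split.
- by apply: measurableC; exact: measurable_superlevel.
- rewrite setCK -(@lee_pmul2l _ (expR t)%:E)//; last exact: expR_gt0.
  apply: (le_trans (markov_ge0 R d T P F _ mF F_ge0 (expR_gt0 t))).
  by rewrite int_F -EFinM -expRD subrr expR0.
move=> w /= /negP; rewrite -ltNge => Fw x y x1 y1.
have [p1 [h1 [[p1_ge0 p1_sum] p1_le p1_mean p1_second p1_ent]]] := smooth1 x x1.
have [p2 [h2 [[p2_ge0 p2_sum] p2_le p2_mean p2_second p2_ent]]] := smooth2 y y1.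
pose p (e : K1 * K2) := p1 e.1 * p2 e.2.
pose h (e : K1 * K2) := h1 e.1 + h2 e.2.
have jensen : expR (\sum_e p e * (f w e - h e)) <= F w.
  apply: jensen_change_of_measure.
  - by move=> e; rewrite mulr_ge0.
  - by rewrite (sum_pair_mul R K1 K2 p1 p2) p1_sum p2_sum mulr1.
  - move=> e; rewrite /p /pi /h expRD mulrACA.
    by apply: ler_pM.
have {jensen} : \sum_e p e * (f w e - h e) <= t.
  by rewrite -ler_expR; exact: (le_trans jensen (ltW Fw)).
have ent : \sum_e p e * h e = \sum_e p1 e * h1 e + \sum_e p2 e * h2 e.
  transitivity (\sum_(e : K1 * K2) (p1 e.1 * h1 e.1 * p2 e.2 + p1 e.1 * (p2 e.2 * h2 e.2))).
    by apply: eq_bigr => e _; rewrite /p /h; ring.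
  rewrite big_split/= (sum_pair_mul R K1 K2 (fun e => p1 e * h1 e) p2).
  rewrite (sum_pair_mul R K1 K2 p1 (fun e => p2 e * h2 e)).
  by rewrite p1_sum p2_sum mulr1 mul1r.
have fE e : f w e = lam * (\sum_i \sum_j X1 e.1 i * Phi w i j * X2 e.2 j) -
    lam ^+ 2 / 2 * ((\sum_i X1 e.1 i ^+ 2) * (\sum_j X2 e.2 j ^+ 2)).
  rewrite big_distrlr/= !mulr_sumr -sumrN -big_split/=; apply: eq_bigr => i _.
  rewrite !mulr_sumr -sumrN -big_split/=; apply: eq_bigr => j _.
  by rewrite /a; field.
(* Under the product posterior the two vectors are independent, so the bilinear form averages to its
   value at the means and the quadratic term to a product of second moments. *)
have mean : \sum_e p e * f w e = lam * (\sum_i \sum_j x i * Phi w i j * y j) -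
    lam ^+ 2 / 2 * ((\sum_e p1 e * \sum_i X1 e i ^+ 2) * (\sum_e p2 e * \sum_j X2 e j ^+ 2)).
  under eq_bigr do rewrite fE mulrBr.
  rewrite big_split/= sumrN; congr (_ - _).
    under eq_bigr do rewrite mulrCA mulr_sumr.
    rewrite -mulr_sumr exchange_big/=; congr (_ * _); apply: eq_bigr => i _.
    under eq_bigr do rewrite mulr_sumr.
    rewrite exchange_big/=; apply: eq_bigr => j _.
    rewrite -(p1_mean i) -(p2_mean j).
    transitivity (\sum_(e : K1 * K2) (Phi w i j * ((p1 e.1 * X1 e.1 i) * (p2 e.2 * X2 e.2 j)))).
      by apply: eq_bigr => e _; rewrite /p; ring.
    rewrite -mulr_sumr (sum_pair_mul R K1 K2 (fun e => p1 e * X1 e i) (fun e => p2 e * X2 e j)).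
    by ring.
  transitivity (\sum_(e : K1 * K2) lam ^+ 2 / 2 *
      ((p1 e.1 * \sum_i X1 e.1 i ^+ 2) * (p2 e.2 * \sum_j X2 e.2 j ^+ 2))).
    apply: eq_bigr => e _; rewrite /p.
    set S1 := \sum_i _; set S2 := \sum_j _; by field.
  rewrite -mulr_sumr (sum_pair_mul R K1 K2 (fun e => p1 e * \sum_i X1 e i ^+ 2)
    (fun e => p2 e * \sum_j X2 e j ^+ 2)).
  by [].
have -> : \sum_e p e * (f w e - h e) = \sum_e p e * f w e - \sum_e p e * h e.
  by rewrite -sumrB; apply: eq_bigr => e _; rewrite mulrBr.
rewrite ent mean.
have second : (\sum_e p1 e * \sum_i X1 e i ^+ 2) * (\sum_e p2 e * \sum_j X2 e j ^+ 2) <=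
    (1 + k%:R * q1) * (1 + L%:R * q2).
  apply: ler_pM => //; apply: sumr_ge0 => e _; rewrite mulr_ge0//; apply: sumr_ge0 => i _;
    exact: sqr_ge0.
have := ler_wpM2l (divr_ge0 (sqr_ge0 lam) (ler0n R 2)) second.
move: second p1_ent p2_ent; set A := _ * _ => _.
set B := \sum_e p1 e * h1 e; set C := \sum_e p2 e * h2 e.
set D := lam ^+ 2 / 2 * A; set E := lam ^+ 2 / 2 * _.
lra.
Qed.

(** Duality: test the bilinear bound on [x] and on its image under the transpose of [Phi], both
    normalized. *)
Lemma bilinear_bound_adjoint (R : realType) (k L : nat) (Phi : 'M[R]_(k, L)) (M : R) :
  (forall (x : 'I_k -> R) (y : 'I_L -> R),
    \sum_i x i ^+ 2 <= 1 -> \sum_j y j ^+ 2 <= 1 ->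
    \sum_i \sum_j x i * Phi i j * y j <= M) ->
  forall x : 'I_k -> R,
    \sum_j (\sum_i x i * Phi i j) ^+ 2 <= M ^+ 2 * \sum_i x i ^+ 2.
Proof.
move=> hM x; set Y := \sum_j _; set X := \sum_i _ ^+ 2.
have X0 : 0 <= X by apply: sumr_ge0 => i _; exact: sqr_ge0.
have Y0 : 0 <= Y by apply: sumr_ge0 => j _; exact: sqr_ge0.
have [Y_eq0|Yn] := eqVneq Y 0.
  by rewrite Y_eq0; apply: mulr_ge0 => //; exact: sqr_ge0.
have Yp : 0 < Y by rewrite lt_neqAle eq_sym Yn.
have Xp : 0 < X.
  rewrite lt_neqAle X0 andbT eq_sym; apply/negP => /eqP XE.
  have x0 i : x i = 0.
    by move/psumr_eq0P: XE => /(_ (fun i _ => sqr_ge0 _)) /(_ i isT)/eqP; rewrite sqrf_eq0 => /eqP.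
  move/negP: Yn; apply; apply/eqP/big1 => j _.
  by rewrite big1 ?expr0n// => i _; rewrite x0 mul0r.
have sX : 0 < Num.sqrt X by rewrite sqrtr_gt0.
have sY : 0 < Num.sqrt Y by rewrite sqrtr_gt0.
pose g j := \sum_i x i * Phi i j.
have := hM (fun i => x i / Num.sqrt X) (fun j => g j / Num.sqrt Y).
have norm1 (n : nat) (z : 'I_n -> R) (Z : R) : \sum_i z i ^+ 2 = Z -> 0 < Z ->
    \sum_i (z i / Num.sqrt Z) ^+ 2 <= 1.
  move=> ZE Z0; under eq_bigr do rewrite exprMn exprVn.
  by rewrite -mulr_suml ZE sqr_sqrtr ?(ltW Z0)// divff ?lexx// gt_eqF.
move=> /(_ (norm1 _ _ _ erefl Xp) (norm1 _ _ _ erefl Yp)).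
rewrite exchange_big/=.
have -> : \sum_(j < L) \sum_(i < k) x i / Num.sqrt X * Phi i j *
    (g j / Num.sqrt Y) = Y / (Num.sqrt X * Num.sqrt Y).
  rewrite /Y mulr_suml; apply: eq_bigr => j _; rewrite -mulr_suml.
  have -> : \sum_(i < k) x i / Num.sqrt X * Phi i j = g j / Num.sqrt X.
    by rewrite /g mulr_suml; apply: eq_bigr => i _; rewrite mulrAC.
  by rewrite -/(g j); field; rewrite !gt_eqF.
rewrite -{1}(sqr_sqrtr Y0) => h.
have {}h : Num.sqrt Y <= M * Num.sqrt X.
  rewrite -ler_pdivrMr//; apply: le_trans h; rewrite le_eqVlt; apply/orP; left.
  by apply/eqP; field; rewrite !gt_eqF.
rewrite -{1}(sqr_sqrtr Y0) -(sqr_sqrtr X0) -exprMn.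
by rewrite lerXn2r// nnegrE ?(ltW sY)// (le_trans (ltW sY)).
Qed.

(** The constants 2 and 4/3 are 2/3 of the 3 and 2 in the recovery condition, the factor being lost
    to rows of norm as small as [2 / 3 * Num.sqrt L%:R]. *)
Lemma gaussian_operator_norm_tail (R : realType) (d : measure_display)
    (T : measurableType d) (P : probability T R) (k L : nat)
    (Phi : T -> 'M[R]_(k, L)) : iid_std_normal_mx P Phi -> (0 < L)%N ->
  exists G : set T, [/\ measurable G, (P (~` G) <= (expR (- (L%:R / 8)))%:E)%E &
    forall w, G w -> forall x : 'I_k -> R,
      \sum_j (\sum_i x i * Phi w i j) ^+ 2 <=
      (2 * Num.sqrt L%:R + 4 / 3 * Num.sqrt k%:R) ^+ 2 * \sum_i x i ^+ 2].
Proof.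
(* For [k = 0] the parameter [q1] chosen below would degenerate to 0, but every sum over [i] is
   empty. *)
move=> iid L0; have [k0|k0] := posnP k.
  exists setT; split => //; first by rewrite setCT measure0 lee_fin expR_ge0.
  move=> w _ x; rewrite big1 ?mulr_ge0 ?sqr_ge0//.
    by apply: sumr_ge0 => i _; exact: sqr_ge0.
  by move=> j _; rewrite big1 ?expr0n// => i _; exfalso; case: i => i; rewrite k0.
have l0 : 0 < Num.sqrt L%:R :> R by rewrite sqrtr_gt0 ltr0n.
have kap0 : 0 < Num.sqrt k%:R :> R by rewrite sqrtr_gt0 ltr0n.
have lE : L%:R = Num.sqrt L%:R ^+ 2 :> R by rewrite sqr_sqrtr.
have kapE : k%:R = Num.sqrt k%:R ^+ 2 :> R by rewrite sqr_sqrtr.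
(* The parameters nearly minimize the resulting bound. *)
have [G [mG PG hG]] := bilinear_form_tail R d T P k L Phi
  (8 / (11 * (Num.sqrt k%:R * Num.sqrt L%:R))) (3 / (5 * Num.sqrt L%:R ^+ 2))
  (8 / 7 * Num.sqrt L%:R) (L%:R / 8) iid
  (divr_gt0 (ltr0n _ 8) (mulr_gt0 (ltr0n _ 11) (mulr_gt0 kap0 l0)))
  (divr_gt0 (ltr0n _ 3) (mulr_gt0 (ltr0n _ 5) (exprn_gt0 2 l0))).
exists G; split => // w Gw x; apply: bilinear_bound_adjoint => {}x y x1 y1.
have := hG w Gw x y x1 y1; rewrite lE kapE.
rewrite !sqrtr_sqr !gtr0_norm//.
move: l0 kap0; set l := Num.sqrt L%:R; set kap := Num.sqrt k%:R => l0 kap0.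
set S := \sum_i _ => h.
rewrite -(ler_pM2l (mulr_gt0 (divr_gt0 (ltr0n _ 8) (ltr0n _ 7)) l0)).
apply: (le_trans h).
(* After multiplication by [lam], both sides are combinations of [l ^+ 2] and [kap * l], and they
   compare coefficient by coefficient. *)
have -> : (8 / 7 * l) ^+ 2 / 2 * ((1 + kap ^+ 2 * (8 / (11 * (kap * l)))) *
      (1 + l ^+ 2 * (3 / (5 * l ^+ 2)))) +
    11 / 20 / (8 / (11 * (kap * l))) + 11 / 20 / (3 / (5 * l ^+ 2)) + l ^+ 2 / 8 =
  (256 / 245 + 25 / 24) * l ^+ 2 + (2048 / 2695 + 121 / 160) * (kap * l).
  by field; rewrite !gt_eqF.
have -> : 8 / 7 * l * (2 * l + 4 / 3 * kap) = 16 / 7 * l ^+ 2 + 32 / 21 * (kap * l).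
  by field.
have : 0 < kap * l by rewrite mulr_gt0.
have : 0 < l ^+ 2 by rewrite exprn_gt0.
by lra.
Qed.

(** * The bound on [A_L] *)

Definition gamma_integrand (R : realType) (b t : R) : R := powR t b * expR (- t).

(** This is Gamma at [b + 1], kept in the extended reals so that estimates can precede any proof of
    finiteness. *)
Definition gamma_integral (R : realType) (b : R) : \bar R :=
  (\int[lebesgue_measure]_(t in `]0%R, +oo[%classic) (gamma_integrand R b t)%:E)%E.

Lemma gamma_integrand_ge0 (R : realType) (b t : R) : 0 <= gamma_integrand R b t.
Proof. by rewrite mulr_ge0 ?powR_ge0 ?expR_ge0. Qed.

Lemma measurable_gamma_integrand (R : realType) (b : R) (D : set R) :
  measurable D -> measurable_fun D (gamma_integrand R b).
Proof.
move=> mD; apply: measurable_funTS; apply: measurable_funM; first exact: measurable_powR.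
by apply: measurableT_comp => //; exact: measurableT_comp.
Qed.

Lemma is_derive_gamma_integrand (R : realType) (b t : R) : 0 < t ->
  is_derive t 1 (gamma_integrand R b)
    (b * gamma_integrand R (b - 1) t - gamma_integrand R b t).
Proof.
move=> t0.
have d1 : is_derive t 1 (fun s : R => powR s b) (b * powR t (b - 1)).
  exact: is_derive1_powR.
have d2 : is_derive t 1 (fun s : R => expR (- s)) (- expR (- t)).
  have dN : is_derive t 1 (fun s : R => - s) (- 1) by exact: is_deriveNid.
  have dE : is_derive (- t) 1 (@expR R) (expR (- t)) by exact: is_derive_expR.
  rewrite (_ : - expR (- t) = expR (- t) * -1); last by rewrite mulrN1.
  exact: (@is_derive1_comp R (@expR R) (fun s => - s) t _ _ dE dN).
have d := is_deriveM d1 d2.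
rewrite [X in is_derive _ _ X _](_ : _ = (fun s => powR s b) * (fun s => expR (- s)))//.
by apply: is_derive_eq; rewrite /gamma_integrand /GRing.scale/=; ring.
Qed.

Lemma continuous_gamma_integrand (R : realType) (b x y : R) : 0 < x ->
  {within `[x, y], continuous (gamma_integrand R b)}.
Proof.
move=> x0; apply: derivable_within_continuous => t.
rewrite in_itv/= => /andP[xt _].
by have [] := is_derive_gamma_integrand R b t (lt_le_trans x0 xt).
Qed.

(** Integration by parts on a compact interval. The boundary term at [y] has a favourable sign and
    is dropped; the one at [x] is at most [powR x a]. *)
Lemma gamma_truncated_rec (R : realType) (a x y : R) : 0 < a -> 0 < x -> x < y ->
  (\int[lebesgue_measure]_(t in `[x, y]) (gamma_integrand R a t)%:E <=
   a%:E * gamma_integral R (a - 1) + (powR x a)%:E)%E.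
Proof.
move=> a0 x0 xy.
have mItv : measurable (`[x, y]%classic : set R) by [].
pose f t := a * gamma_integrand R (a - 1) t - gamma_integrand R a t.
have cf : {within `[x, y], continuous f}.
  apply: derivable_within_continuous => t; rewrite in_itv/= => /andP[xt _].
  have t0 := lt_le_trans x0 xt.
  have [d1 _] := is_derive_gamma_integrand R (a - 1) t t0.
  have [d2 _] := is_derive_gamma_integrand R a t t0.
  by apply: derivableB => //; apply: derivableM => //; exact: derivable_cst.
have int_cont (g : R -> R) : {within `[x, y], continuous g} ->
    lebesgue_measure.-integrable `[x, y] (EFin \o g).
  by move=> cg; apply: continuous_compact_integrable => //; exact: segment_compact.
have FTC : (\int[lebesgue_measure]_(t in `[x, y]) (f t)%:E =
    (gamma_integrand R a y)%:E - (gamma_integrand R a x)%:E)%E.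
  apply: continuous_FTC2 => //.
  - have dF t : 0 < t -> derivable (gamma_integrand R a) t 1.
      by move=> t0; have [] := is_derive_gamma_integrand R a t t0.
    have cF t : 0 < t -> {for t, continuous (gamma_integrand R a)}.
      by move=> t0; apply/differentiable_continuous/derivable1_diffP/dF.
    split.
    + by move=> t; rewrite in_itv/= => /andP[xt _]; apply: dF; exact: lt_trans xt.
    + by apply: cvg_at_right_filter; exact: cF.
    + by apply: cvg_at_left_filter; apply: cF; exact: lt_trans xy.
  - move=> t; rewrite in_itv/= => /andP[xt _]; rewrite derive1E.
    by have [_ ->] := is_derive_gamma_integrand R a t (lt_trans x0 xt).
have split_int : (\int[lebesgue_measure]_(t in `[x, y]) (gamma_integrand R a t)%:E =
    a%:E * \int[lebesgue_measure]_(t in `[x, y]) (gamma_integrand R (a - 1) t)%:E -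
    \int[lebesgue_measure]_(t in `[x, y]) (f t)%:E)%E.
  rewrite -integralZl//; last by apply: int_cont; exact: continuous_gamma_integrand.
  rewrite -integralB//; last 2 first.
  - by apply: integrableZl => //; apply: int_cont; exact: continuous_gamma_integrand.
  - exact: int_cont.
  by apply: eq_integral => t _; rewrite -EFinM -EFinB; congr (_%:E); rewrite /f; ring.
rewrite split_int FTC; apply: leeD.
  apply: lee_wpmul2l; first by rewrite lee_fin ltW.
  apply: ge0_subset_integral => //.
  - by apply/measurable_EFinP; apply: measurable_gamma_integrand; exact: measurable_itv.
  - by move=> t _; rewrite lee_fin gamma_integrand_ge0.
  - by move=> t /=; rewrite !in_itv/= andbT => /andP[xt _]; exact: lt_le_trans xt.
rewrite -EFinB -EFinN lee_fin opprB.
have hy := gamma_integrand_ge0 R a y.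
have : gamma_integrand R a x <= powR x a.
  by rewrite ler_piMr ?powR_ge0// expR_le1 oppr_le0 ltW.
by lra.
Qed.

(** One direction of the functional equation of Gamma, as a limit of the truncated estimate: the
    boundary term vanishes because [a] is positive. *)
Lemma gamma_integral_rec_le (R : realType) (a : R) : 0 < a ->
  (gamma_integral R a <= a%:E * gamma_integral R (a - 1))%E.
Proof.
move=> a0.
have I0 : (0 <= gamma_integral R (a - 1))%E.
  by apply: integral_ge0 => t _; rewrite lee_fin gamma_integrand_ge0.
have [Ioo|Ifin] := eqVneq (gamma_integral R (a - 1)) +oo%E.
  by rewrite Ioo gt0_muley ?lte_fin// leey.
(* Starting at 2 makes the endpoints strictly ordered already for [n = 0]. *)
pose F n : set R := `[n.+2%:R^-1, n.+2%:R]%classic.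
have FE : `]0, +oo[%classic = \bigcup_n F n.
  apply/seteqP; split=> t /=.
    rewrite in_itv/= andbT => t0.
    have lt_trunc (s : R) m : (Num.truncn s <= m)%N -> s <= m.+2%:R.
      by move=> sm; rewrite ltW// (lt_le_trans (truncnS_gt s))// ler_nat ltnS leqW.
    exists (maxn (Num.truncn t) (Num.truncn t^-1)) => //; rewrite /F/= in_itv/=.
    rewrite lt_trunc ?leq_maxl// andbT -[X in _ <= X]invrK.
    by rewrite lef_pV2 ?posrE ?invr_gt0// lt_trunc ?leq_maxr.
  by move=> [n _]; rewrite /F/= !in_itv/= andbT => /andP[+ _]; apply: lt_le_trans; rewrite invr_gt0.
have cvgI : (\int[lebesgue_measure]_(t in F n) (gamma_integrand R a t)%:E)%E @[n --> \oo]
    --> gamma_integral R a.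
  rewrite /gamma_integral FE; apply: ge0_nondecreasing_set_cvg_integral => //.
  - apply/nondecreasing_seqP => n; rewrite subsetEset => t; rewrite /F/= !in_itv/=.
    move=> /andP[t1 t2]; apply/andP; split.
      by apply: le_trans t1; rewrite lef_pV2 ?posrE ?ler_nat.
    by apply: (le_trans t2); rewrite ler_nat.
  - by move=> n; exact: measurable_itv.
  - by move=> n; apply/measurable_EFinP; apply: measurable_gamma_integrand; exact: measurable_itv.
  - by move=> n t _; rewrite lee_fin gamma_integrand_ge0.
have cvgB : (a%:E * gamma_integral R (a - 1) + (powR (n.+2%:R^-1 : R) a)%:E)%E @[n --> \oo]
    --> (a%:E * gamma_integral R (a - 1) + 0)%E.
  apply: cvgeD.
  - by rewrite fin_num_adde_defl.
  - exact: cvg_cst.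
  - apply: cvg_EFin; first exact: nearW.
    have /cvg_at_rightP h := @powR_cvg0 R a a0.
    apply: (h (fun n => n.+2%:R^-1)); split; first by move=> n; rewrite invr_gt0.
    by have := @cvg_harmonic R; rewrite -cvg_shiftS.
rewrite -[X in (_ <= X)%E]adde0.
apply: (lee_cvg_to cvgI cvgB); apply: nearW => n.
apply: gamma_truncated_rec => //.
by apply: (@lt_trans _ _ 1); rewrite ?invf_lt1 ?ltr1n.
Qed.

(** Integrate [2 * Num.sqrt a * Num.sqrt t <= a + t] against [powR t (a - 1) * expR (- t)]; by the
    recursion the right side is at most [2 * a] times the integral of exponent [a - 1]. *)
Lemma gamma_integral_half_le (R : realType) (a : R) : 0 < a ->
  (gamma_integral R (a - 2^-1) <= (Num.sqrt a)%:E * gamma_integral R (a - 1))%E.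
Proof.
move=> a0; have sa0 : 0 < Num.sqrt a by rewrite sqrtr_gt0.
have mI b : measurable_fun (`]0, +oo[%classic : set R) (EFin \o gamma_integrand R b).
  by apply/measurable_EFinP; apply: measurable_gamma_integrand; exact: measurable_itv.
have g0 b t : (0 <= (gamma_integrand R b t)%:E)%E by rewrite lee_fin gamma_integrand_ge0.
have I0 b : (0 <= gamma_integral R b)%E by exact: integral_ge0.
have amgm : ((2 * Num.sqrt a)%:E * gamma_integral R (a - 2^-1) <=
    a%:E * gamma_integral R (a - 1) + gamma_integral R a)%E.
  have ZI (c b : R) : 0 <= c -> (c%:E * gamma_integral R b =
      \int[lebesgue_measure]_(t in `]0%R, +oo[%classic) (c%:E * (gamma_integrand R b t)%:E))%E.
    by move=> c0; rewrite ge0_integralZl//; exact: mI.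
  have mZI (c b : R) : measurable_fun (`]0, +oo[%classic : set R)
      (fun t => c%:E * (gamma_integrand R b t)%:E)%E.
    by apply: emeasurable_funM; [exact: measurable_cst|exact: mI].
  rewrite !ZI ?mulr_ge0 ?(ltW a0) ?(ltW sa0)// /gamma_integral.
  rewrite -ge0_integralD//; last 3 first.
  - by move=> t _; rewrite mule_ge0// lee_fin ltW.
  - exact: mZI.
  - exact: mI.
  apply: ge0_le_integral => //.
  - by move=> t _; rewrite mule_ge0// lee_fin mulr_ge0// ltW.
  - exact: mZI.
  - by apply: emeasurable_funD => //; [exact: mZI|exact: mI].
  move=> t; rewrite /= in_itv/= andbT => t0.
  have tn0 : t != 0 by rewrite gt_eqF.
  rewrite -!EFinM -EFinD lee_fin /gamma_integrand.
  rewrite (_ : a - 2^-1 = (a - 1) + 2^-1); last by field.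
  rewrite powRD ?tn0 ?implybT// powR12_sqrt ?(ltW t0)//.
  rewrite [powR t a](_ : _ = powR t (a - 1) * t); last first.
    by rewrite -[X in _ = _ * X](powRr1 (ltW t0)) -powRD ?tn0 ?implybT// subrK.
  have -> : 2 * Num.sqrt a * (powR t (a - 1) * Num.sqrt t * expR (- t)) =
      powR t (a - 1) * expR (- t) * (2 * Num.sqrt a * Num.sqrt t) by ring.
  have -> : a * (powR t (a - 1) * expR (- t)) + powR t (a - 1) * t * expR (- t) =
      powR t (a - 1) * expR (- t) * (a + t) by ring.
  apply: ler_wpM2l; first by rewrite mulr_ge0 ?powR_ge0 ?expR_ge0.
  have := sqr_ge0 (Num.sqrt a - Num.sqrt t).
  by rewrite sqrrB (sqr_sqrtr (ltW a0)) (sqr_sqrtr (ltW t0)); lra.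
have {amgm} := le_trans amgm (leeD2l _ (gamma_integral_rec_le R a a0)).
move: (I0 (a - 2^-1)) (I0 (a - 1)).
case: (gamma_integral R (a - 1)) => [r| |]//; last first.
  by move=> _ _ _; rewrite gt0_muley ?lte_fin// leey.
case: (gamma_integral R (a - 2^-1)) => [s| |]//; last first.
  by move=> _ _; rewrite gt0_muley ?lte_fin ?mulr_gt0.
move=> _ _; rewrite -!EFinM -EFinD !lee_fin => h.
rewrite -(ler_pM2l (mulr_gt0 (ltr0n R 2) sa0)); apply: (le_trans h).
by rewrite -{1 2}(sqr_sqrtr (ltW a0)) le_eqVlt; apply/orP; left; apply/eqP; ring.
Qed.

(** With [a = L / 2], the half-step bound makes the quotient of Gamma values at most [Num.sqrt a],
    and [2 * a = L]. *)
Lemma A_L_sqr_le (R : realType) (L : nat) : (0 < L)%N -> A_L R L ^+ 2 <= L%:R.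
Proof.
move=> L0; set a : R := L%:R / 2.
have a0 : 0 < a by rewrite divr_gt0 ?ltr0n.
have GE (b : R) : Gamma b = fine (gamma_integral R (b - 1)) by [].
have I0 b : (0 <= gamma_integral R b)%E.
  by apply: integral_ge0 => t _; rewrite lee_fin gamma_integrand_ge0.
have G0 (b : R) : 0 <= Gamma b by rewrite GE fine_ge0.
rewrite /A_L -/a (_ : (L%:R + 1) / 2 = a + 2^-1); last by rewrite /a; field.
(* The value 0 covers a divergent integral, which [fine] sends to 0; the quotient is then 0 by
   convention. Otherwise the integral is finite and the extended estimate descends to the reals. *)
have [->|Ga] := eqVneq (Gamma a) 0; first by rewrite invr0 mulr0 expr0n/= ler0n.
have Gap : 0 < Gamma a by rewrite lt_neqAle eq_sym Ga G0.
have h : Gamma (a + 2^-1) <= Num.sqrt a * Gamma a.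
  have := gamma_integral_half_le R a a0.
  move: Ga; rewrite !GE (_ : a + 2^-1 - 1 = a - 2^-1); last by field.
  have := I0 (a - 2^-1); have := I0 (a - 1).
  case: (gamma_integral R (a - 1)) => [r| |]//=; rewrite ?eqxx//.
  by case: (gamma_integral R (a - 2^-1)) => [s| |].
have {}h : Num.sqrt 2 * Gamma (a + 2^-1) / Gamma a <= Num.sqrt L%:R.
  rewrite ler_pdivrMr// (_ : L%:R = 2 * a); last by rewrite /a; field.
  by rewrite sqrtrM// -mulrA ler_wpM2l.
have LE : L%:R = Num.sqrt L%:R ^+ 2 :> R by rewrite sqr_sqrtr.
by rewrite [X in _ <= X]LE lerXn2r// nnegrE ?sqrtr_ge0// divr_ge0// mulr_ge0.
Qed.

(** * Dual certificates *)

(** Cauchy-Schwarz inequality, from Lagrange's identity. *)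
Lemma sum_mul_le_sqrt (R : realType) (I : finType) (a b : I -> R) :
  \sum_i a i * b i <= Num.sqrt (\sum_i a i ^+ 2) * Num.sqrt (\sum_i b i ^+ 2).
Proof.
have sum_sqr_ge0 (c : I -> R) : 0 <= \sum_i c i ^+ 2.
  by apply: sumr_ge0 => i _; exact: sqr_ge0.
have lagrange : \sum_i \sum_j (a i * b j - a j * b i) ^+ 2 =
    2 * ((\sum_i a i ^+ 2) * (\sum_i b i ^+ 2) - (\sum_i a i * b i) ^+ 2).
  have -> : (\sum_i a i ^+ 2) * (\sum_i b i ^+ 2) =
      \sum_i \sum_j a i ^+ 2 * b j ^+ 2 by rewrite big_distrlr.
  have -> : (\sum_i a i * b i) ^+ 2 = \sum_i \sum_j (a i * b i) * (a j * b j).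
    by rewrite expr2 big_distrlr.
  have swap : \sum_i \sum_j a i ^+ 2 * b j ^+ 2 = \sum_i \sum_j a j ^+ 2 * b i ^+ 2.
    by rewrite exchange_big.
  rewrite mulrBr mulr2n mulrDl !mul1r {2}swap mulr_sumr -!sumrN -!big_split/=.
  apply: eq_bigr => i _; rewrite mulr_sumr -sumrN -!big_split/=.
  by apply: eq_bigr => j _; ring.
rewrite -sqrtrM//; apply: (le_trans (ler_norm _)); rewrite -sqrtr_sqr ler_wsqrtr//.
have : 0 <= \sum_i \sum_j (a i * b j - a j * b i) ^+ 2.
  by apply: sumr_ge0 => i _; apply: sumr_ge0 => j _; exact: sqr_ge0.
by rewrite lagrange; lra.
Qed.

Lemma normc_sqr (R : realType) (z : R[i]) :
  Normc.normc z ^+ 2 = complex.Re z ^+ 2 + complex.Im z ^+ 2.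
Proof. by case: z => x y; rewrite /= sqr_sqrtr// addr_ge0 ?sqr_ge0. Qed.

Lemma Re_le_normc (R : realType) (z : R[i]) : complex.Re z <= Normc.normc z.
Proof.
case: z => x y /=; apply: (le_trans (ler_norm x)).
by rewrite -sqrtr_sqr ler_wsqrtr// lerDl sqr_ge0.
Qed.

Lemma Re_sum (R : realType) (I : Type) (s : seq I) (Q : pred I) (F : I -> R[i]) :
  complex.Re (\sum_(i <- s | Q i) F i) = \sum_(i <- s | Q i) complex.Re (F i).
Proof. by apply: (big_morph (@complex.Re R)) => // -[? ?] [? ?]. Qed.

Lemma Im_sum (R : realType) (I : Type) (s : seq I) (Q : pred I) (F : I -> R[i]) :
  complex.Im (\sum_(i <- s | Q i) F i) = \sum_(i <- s | Q i) complex.Im (F i).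
Proof. by apply: (big_morph (@complex.Im R)) => // -[? ?] [? ?]. Qed.

Lemma Re_mul_real (R : realType) (z : R[i]) (x : R) :
  complex.Re (z * real_complex R x) = complex.Re z * x.
Proof. by case: z => a b /=; rewrite mulr0 subr0. Qed.

Lemma Im_mul_real (R : realType) (z : R[i]) (x : R) :
  complex.Im (z * real_complex R x) = complex.Im z * x.
Proof. by case: z => a b /=; rewrite mulr0 add0r. Qed.

Lemma normc_real (R : realType) (x : R) : Normc.normc (real_complex R x) = `|x|.
Proof. by rewrite /= expr0n/= addr0 sqrtr_sqr. Qed.

Lemma Re_sum_mul_le (R : realType) (I : finType) (z w : I -> R[i]) :
  complex.Re (\sum_i z i * w i) <=
  Num.sqrt (\sum_i Normc.normc (z i) ^+ 2) * Num.sqrt (\sum_i Normc.normc (w i) ^+ 2).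
Proof.
apply: le_trans (sum_mul_le_sqrt R I _ _); rewrite Re_sum; apply: ler_sum => i _.
by rewrite -Normc.normcM Re_le_normc.
Qed.

Lemma rownorm2_eq0 (R : realType) m n (Z : 'M[R[i]]_(m, n)) r j :
  rownorm2 Z r = 0 -> Z r j = 0.
Proof.
have sq_ge0 j' : true -> 0 <= Normc.normc (Z r j') ^+ 2 by rewrite sqr_ge0.
move/eqP; rewrite sqrtr_eq0 => h.
have /psumr_eq0P : \sum_j Normc.normc (Z r j) ^+ 2 = 0.
  by apply/eqP; rewrite eq_le h sumr_ge0.
by move=> /(_ sq_ge0 j isT)/eqP; rewrite sqrf_eq0 => /eqP/Normc.eq0_normc.
Qed.

(** The Gram matrix is invertible: if [v] annihilates it, then [v *m adjmx M] times its own adjoint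
    is zero, so [v *m adjmx M] vanishes, and full column rank gives [v = 0]. *)
Lemma pinvS_mul (R : realType) n k (M : 'M[R[i]]_(n, k)) :
  \rank M = k -> pinvS M *m M = 1%:M.
Proof.
move=> rM; rewrite /pinvS -mulmxA mulVmx// -row_free_unit.
have adj_free : row_free (adjmx M).
  by rewrite /row_free /adjmx mxrank_map mxrank_tr rM.
apply: inj_row_free => v; rewrite mulmxA => vMM.
have w0 j : (v *m adjmx M) 0 j = 0.
  have adjE : (v *m adjmx M) *m (adjmx (v *m adjmx M)) = 0.
    have -> : adjmx (v *m adjmx M) = M *m adjmx v.
      rewrite {1}/adjmx trmx_mul map_mxM; congr (_ *m _).
      by apply/matrixP => a b; rewrite /adjmx !mxE; exact: conjcK.
    by rewrite mulmxA vMM mul0mx.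
  have : complex.Re (((v *m adjmx M) *m adjmx (v *m adjmx M)) 0 0) = 0.
    by rewrite adjE mxE.
  rewrite mxE Re_sum.
  have sq j' : complex.Re ((v *m adjmx M) 0 j' * adjmx (v *m adjmx M) j' 0) =
      Normc.normc ((v *m adjmx M) 0 j') ^+ 2.
    rewrite {2}/adjmx !mxE normc_sqr; case: (\sum_j _) => x y /=.
    by ring.
  under eq_bigr do rewrite sq.
  move/psumr_eq0P => /(_ (fun i _ => sqr_ge0 _) j isT)/eqP.
  by rewrite sqrf_eq0 => /eqP/Normc.eq0_normc.
have : v *m adjmx M = 0 *m adjmx M.
  by apply/matrixP => a b; rewrite (ord1 a) w0 mul0mx mxE.
by move/(row_free_inj adj_free).
Qed.

(** The rows of [U] are subgradients of the norm at the rows of [X] in [S]. For a feasible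
    [Z = X + H], the equation [A *m H = 0] expresses the rows of [H] in [S] through the others, so
    the norm drops by at most the sum of [rownorm2 H l * W l] on [S] and grows by that of
    [rownorm2 H l] outside. *)
Lemma dual_certificate (R : realType) (n N L : nat) (A : 'M[R[i]]_(n, N))
    (S : {set 'I_N}) (X : 'M[R]_(N, L)) (U : 'M[R]_(#|S|, L)) :
  \rank (colsS A S) = #|S| ->
  (forall r j, r \notin S -> X r j = 0) ->
  (forall i, \sum_j U i j ^+ 2 <= 1) ->
  (forall i, \sum_j X (enum_val i) j * U i j = Num.sqrt (\sum_j X (enum_val i) j ^+ 2)) ->
  (forall l, l \notin S ->
    \sum_j Normc.normc (\sum_i (pinvS (colsS A S) *m col l A) i 0 *
      real_complex R (U i j)) ^+ 2 < 1) ->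
  unique_l21_solution A (map_mx (real_complex R) X).
Proof.
move=> rA X0 U1 XU V1; set Xc := map_mx _ X.
pose V l := pinvS (colsS A S) *m col l A.
pose W l := Num.sqrt (\sum_j Normc.normc (\sum_i V l i 0 * real_complex R (U i j)) ^+ 2).
have W1 l : l \notin S -> W l < 1.
  by move=> lS; rewrite -[X in _ < X]sqrtr1 ltr_sqrt// V1.
have key (Z : 'M[R[i]]_(N, L)) : A *m Z = A *m Xc ->
    norm21 Xc + \sum_(l | l \notin S) rownorm2 (Z - Xc) l * (1 - W l) <= norm21 Z /\
    forall i j, (Z - Xc) (enum_val i) j = - \sum_(l | l \notin S) V l i 0 * (Z - Xc) l j.
  move=> AZ; set H := Z - Xc.
  have AH : A *m H = 0 by rewrite mulmxBr AZ subrr.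
  have HS i j : H (enum_val i) j = - \sum_(l | l \notin S) V l i 0 * H l j.
    have AHS : colsS A S *m (\matrix_(i, j) H (enum_val i) j) =
        - \sum_(l | l \notin S) col l A *m row l H.
      apply/matrixP => a b; rewrite !mxE summxE.
      have := congr1 (fun M : 'M[R[i]]_(n, L) => M a b) AH; rewrite !mxE.
      rewrite (bigID [in S])/= big_enum_val => /eqP; rewrite addr_eq0 => /eqP E.
      transitivity (\sum_(i < #|S|) A a (enum_val i) * H (enum_val i) b).
        by apply: eq_bigr => c _; rewrite !mxE.
      rewrite E; congr (- _); apply: eq_bigr => l _.
      by rewrite !mxE big_ord1 !mxE.
    have := congr1 (mulmx (pinvS (colsS A S))) AHS.
    rewrite mulmxA pinvS_mul// mul1mx mulmxN mulmx_sumr => /matrixP/(_ i j).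
    rewrite !mxE summxE => ->; congr (- _); apply: eq_bigr => l _.
    by rewrite mulmxA mxE big_ord1 !mxE.
  split=> //.
  have split_norm (Y : 'M[R[i]]_(N, L)) : norm21 Y =
      \sum_(i < #|S|) rownorm2 Y (enum_val i) + \sum_(l | l \notin S) rownorm2 Y l.
    by rewrite /norm21 (bigID [in S])/= big_enum_val.
  have off l : l \notin S -> rownorm2 Xc l = 0 /\ rownorm2 Z l = rownorm2 H l.
    move=> lS; split.
      rewrite /rownorm2 big1 ?sqrtr0// => j _.
      by rewrite mxE normc_real X0// normr0 expr0n.
    congr (Num.sqrt _); apply: eq_bigr => j _.
    by rewrite /H !mxE X0// subr0.
  (* Pairing with [U] attains the norm of a row of [X] and is at most the norm of the same row of
     [Z]; real parts appear because competitors are complex. *)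
  have on i : rownorm2 Xc (enum_val i) +
      complex.Re (\sum_j H (enum_val i) j * real_complex R (U i j)) <=
      rownorm2 Z (enum_val i).
    have -> : rownorm2 Xc (enum_val i) =
        complex.Re (\sum_j Xc (enum_val i) j * real_complex R (U i j)).
      rewrite /rownorm2; under eq_bigr do rewrite mxE normc_real real_normK ?num_real//.
      rewrite -XU Re_sum; apply: eq_bigr => j _.
      by rewrite Re_mul_real mxE.
    rewrite -[X in X <= _](_ : complex.Re (\sum_j Z (enum_val i) j * real_complex R (U i j)) = _);
        last first.
      rewrite !Re_sum -big_split/=; apply: eq_bigr => j _.
      rewrite !Re_mul_real -mulrDl; congr (_ * _); rewrite /H !mxE.
      by case: (Z _ _) => ? ?; rewrite /= addrC subrK.
    apply: (le_trans (Re_sum_mul_le R _ _ _)).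
    rewrite -[X in _ <= X]mulr1 ler_wpM2l ?sqrtr_ge0// -[X in _ <= X]sqrtr1 ler_wsqrtr//.
    by under eq_bigr do rewrite normc_real real_normK ?num_real//.
  (* Substituting [HS] and exchanging sums moves the pairing to the rows outside [S], where
     Cauchy-Schwarz brings in [W]. *)
  have dual : - \sum_(l | l \notin S) rownorm2 H l * W l <=
      \sum_i complex.Re (\sum_j H (enum_val i) j * real_complex R (U i j)).
    rewrite -Re_sum.
    have -> : \sum_i \sum_j H (enum_val i) j * real_complex R (U i j) =
        \sum_(l | l \notin S) \sum_j H l j *
          - (\sum_i V l i 0 * real_complex R (U i j)).
      transitivity (\sum_(i < #|S|) \sum_j \sum_(l | l \notin S)
          - (V l i 0 * H l j * real_complex R (U i j))).
        apply: eq_bigr => i _; apply: eq_bigr => j _.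
        by rewrite HS mulNr mulr_suml sumrN.
      under eq_bigr do rewrite exchange_big/=.
      rewrite exchange_big/=; apply: eq_bigr => l _.
      rewrite exchange_big/=; apply: eq_bigr => j _.
      rewrite mulrN mulr_sumr -sumrN; apply: eq_bigr => i _.
      by congr (- _); rewrite mulrAC mulrC mulrA.
    rewrite Re_sum -sumrN; apply: ler_sum => l _.
    rewrite lerNl -[X in X <= _](_ : complex.Re (\sum_j H l j *
        (\sum_i V l i 0 * real_complex R (U i j))) = _); last first.
      rewrite !Re_sum -sumrN; apply: eq_bigr => j _.
      by rewrite mulrN; case: (H l j * _) => ? ? /=; rewrite opprK.
    exact: Re_sum_mul_le.
  rewrite !split_norm [X in _ + X + _ <= _]big1; last by move=> l /off[].
  rewrite addr0.
  have -> : \sum_(l | l \notin S) rownorm2 Z l = \sum_(l | l \notin S) rownorm2 H l.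
    by apply: eq_bigr => l /off[].
  under [X in _ + X <= _]eq_bigr do rewrite mulrBr mulr1.
  rewrite big_split/= sumrN.
  have : \sum_(i < #|S|) (rownorm2 Xc (enum_val i) +
      complex.Re (\sum_j H (enum_val i) j * real_complex R (U i j))) <=
      \sum_(i < #|S|) rownorm2 Z (enum_val i) by apply: ler_sum => i _; exact: on.
  by rewrite big_split/=; lra.
have rn_ge0 (Z : 'M[R[i]]_(N, L)) l : 0 <= rownorm2 Z l by exact: sqrtr_ge0.
have gain_ge0 (Z : 'M[R[i]]_(N, L)) l : l \notin S -> 0 <= rownorm2 Z l * (1 - W l).
  by move=> lS; rewrite mulr_ge0// subr_ge0 ltW// W1.
split.
  split=> // Z AZ; apply: le_trans (key Z AZ).1.
  by rewrite lerDl sumr_ge0// => l lS; exact: gain_ge0.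
move=> Z [AZ Zmin]; have [gain HS] := key Z AZ.
(* For a minimizer the gain is zero, and [1 - W l] is positive, so each row of the difference
   outside [S] vanishes. *)
have H0 l j : l \notin S -> (Z - Xc) l j = 0.
  move=> lS; apply: rownorm2_eq0.
  have /psumr_eq0P : \sum_(l | l \notin S) rownorm2 (Z - Xc) l * (1 - W l) = 0.
    apply/eqP; rewrite eq_le sumr_ge0 ?andbT => [|l' l'S]; last exact: gain_ge0.
    by have := Zmin Xc erefl; lra.
  move=> /(_ (gain_ge0 _) l lS)/eqP; rewrite mulf_eq0 => /orP[/eqP//|].
  by rewrite subr_eq0 gt_eqF// W1.
apply/eqP; rewrite -subr_eq0; apply/eqP/matrixP => r j; rewrite [RHS]mxE.
have [rS|rS] := boolP (r \in S); last exact: H0.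
rewrite -(enum_rankK_in rS rS) HS big1 ?oppr0// => l lS.
by rewrite H0// mulr0.
Qed.

(** * Recovery with high probability *)

Lemma measure_bigsetU_le (R : realType) (d : measure_display)
    (T : measurableType d) (mu : {measure set T -> \bar R}) (I : Type) (s : seq I)
    (B : I -> set T) : (forall i, measurable (B i)) ->
  (mu (\big[setU/set0]_(i <- s) B i) <= \sum_(i <- s) mu (B i))%E.
Proof.
move=> mB; elim: s => [|i s IH]; first by rewrite !big_nil measure0.
rewrite !big_cons; apply: le_trans (leeD2l _ IH); apply: measureU2 => //.
exact: bigsetU_measurable.
Qed.

(** The certificate consists of the normalized rows of [F], which are also those of [X] as [sigma]
    is positive. Dividing by the row norms costs a factor [3 / (2 * Num.sqrt L%:R)], and 3/2 times
    the operator bound is the denominator in the condition on [A]. *)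
Lemma unique_solution_of_bounds (R : realType) (n N L : nat) (A : 'M[R[i]]_(n, N))
    (S : {set 'I_N}) (sigma : 'rV[R]_#|S|) (F : 'M[R]_(#|S|, L)) (X : 'M[R]_(N, L)) :
  (0 < L)%N ->
  \rank (colsS A S) = #|S| ->
  (forall i, 0 < sigma 0 i) ->
  (forall r j, r \notin S -> X r j = 0) ->
  (forall i j, X (enum_val i) j = (diag_mx sigma *m F) i j) ->
  (forall l, l \notin S -> vnorm2 (pinvS (colsS A S) *m col l A)
     < Num.sqrt L%:R / (3 * Num.sqrt L%:R + 2 * Num.sqrt #|S|%:R)) ->
  (forall i, 4 / 9 * L%:R <= \sum_j F i j ^+ 2) ->
  (forall x : 'I_#|S| -> R, \sum_j (\sum_i x i * F i j) ^+ 2 <=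
     (2 * Num.sqrt L%:R + 4 / 3 * Num.sqrt #|S|%:R) ^+ 2 * \sum_i x i ^+ 2) ->
  unique_l21_solution A (map_mx (real_complex R) X).
Proof.
move=> L0 rA sigma0 X0 XE gammaA row_lb op_ub.
pose rho i := Num.sqrt (\sum_j F i j ^+ 2).
have LR0 : 0 < L%:R :> R by rewrite ltr0n.
have row_gt0 i : 0 < \sum_j F i j ^+ 2.
  by apply: lt_le_trans (row_lb i); rewrite mulr_gt0//; lra.
have rho0 i : 0 < rho i by rewrite sqrtr_gt0.
have rho2 i : rho i ^+ 2 = \sum_j F i j ^+ 2 by rewrite sqr_sqrtr// ltW.
have XF i j : X (enum_val i) j = sigma 0 i * F i j by rewrite XE mul_diag_mx mxE.
apply: (@dual_certificate R n N L A S X (\matrix_(i, j) (F i j / rho i))) => //.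
- move=> i; under eq_bigr do rewrite mxE exprMn exprVn.
  by rewrite -mulr_suml rho2 divff// gt_eqF.
- move=> i; under eq_bigr do rewrite mxE XF.
  under [in RHS]eq_bigr do rewrite XF exprMn.
  rewrite -mulr_sumr sqrtrM ?sqr_ge0// sqrtr_sqr gtr0_norm// -/(rho i).
  transitivity (\sum_j sigma 0 i / rho i * F i j ^+ 2).
    by apply: eq_bigr => j _; field; rewrite gt_eqF.
  by rewrite -mulr_sumr -rho2; field; rewrite gt_eqF.
move=> l lS; set v := pinvS _ *m _.
have op_part (x : 'I_#|S| -> R) : \sum_j (\sum_i x i / rho i * F i j) ^+ 2 <=
    (2 * Num.sqrt L%:R + 4 / 3 * Num.sqrt #|S|%:R) ^+ 2 *
    (9 / (4 * L%:R) * \sum_i x i ^+ 2).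
  apply: (le_trans (op_ub (fun i => x i / rho i))).
  apply: ler_wpM2l; first exact: sqr_ge0.
  rewrite mulr_sumr; apply: ler_sum => i _; rewrite exprMn exprVn rho2 mulrC.
  apply: ler_wpM2r; first exact: sqr_ge0.
  rewrite (_ : 9 / (4 * L%:R) = (4 / 9 * L%:R)^-1); last by field; rewrite gt_eqF.
  by rewrite lef_pV2 ?posrE//; rewrite mulr_gt0//; lra.
(* The certificate is real, so the real and imaginary parts of [v] are transformed separately. *)
have -> : \sum_j Normc.normc (\sum_i v i 0 *
      real_complex R ((\matrix_(i, j) (F i j / rho i)) i j)) ^+ 2 =
    \sum_j (\sum_i complex.Re (v i 0) / rho i * F i j) ^+ 2 +
    \sum_j (\sum_i complex.Im (v i 0) / rho i * F i j) ^+ 2.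
  rewrite -big_split/=; apply: eq_bigr => j _; rewrite normc_sqr Re_sum Im_sum.
  by congr (_ ^+ 2 + _ ^+ 2); apply: eq_bigr => i _;
    rewrite mxE ?Re_mul_real ?Im_mul_real mulrA mulrAC.
apply: (le_lt_trans (lerD (op_part _) (op_part _))).
rewrite -!mulrDr -big_split/=.
under eq_bigr do rewrite -normc_sqr.
have l0 : 0 < Num.sqrt L%:R :> R by rewrite sqrtr_gt0.
have lE : L%:R = Num.sqrt L%:R ^+ 2 :> R by rewrite sqr_sqrtr// ltW.
have kap0 : 0 <= Num.sqrt #|S|%:R :> R by exact: sqrtr_ge0.
have v2 : \sum_i Normc.normc (v i 0) ^+ 2 <
    (Num.sqrt L%:R / (3 * Num.sqrt L%:R + 2 * Num.sqrt #|S|%:R)) ^+ 2.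
  rewrite -[X in X < _]sqr_sqrtr; last by apply: sumr_ge0 => i _; exact: sqr_ge0.
  by rewrite ltrXn2r//; exact: gammaA.
move: v2; rewrite (_ : 9 / (4 * L%:R) = 9 / (4 * Num.sqrt L%:R ^+ 2)); last by rewrite -lE.
move: l0 kap0; set ll := Num.sqrt L%:R; set kap := Num.sqrt _.
set w := \sum_i _ => l0 kap0 v2.
have D0 : 0 < 3 * ll + 2 * kap by lra.
rewrite [X in X < _](_ : _ = ((3 * ll + 2 * kap) / ll) ^+ 2 * w); last first.
  by field; rewrite gt_eqF.
apply: (lt_le_trans (_ : _ < ((3 * ll + 2 * kap) / ll) ^+ 2 *
  (ll / (3 * ll + 2 * kap)) ^+ 2)).
  by rewrite ltr_pM2l// exprn_gt0// divr_gt0.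
by rewrite -exprMn le_eqVlt; apply/orP; left; apply/eqP; field; rewrite !gt_eqF.
Qed.

(** The probability is that of a measurable event inside the set of exact recovery, which spares a
    proof that this set is measurable. *)
Theorem theorem4 (R : realType) (d : measure_display) (T : measurableType d)
    (P : probability T R) (n N L : nat) (A : 'M[R[i]]_(n, N)) (S : {set 'I_N})
    (sigma : 'rV[R]_#|S|) (Phi : T -> 'M[R]_(#|S|, L)) (X : T -> 'M[R]_(N, L)) :
  (0 < L)%N ->
  \rank (colsS A S) = #|S| ->
  (forall i, 0 < sigma 0 i) ->
  iid_std_normal_mx P Phi ->
  (forall w (r : 'I_N) j, r \notin S -> X w r j = 0) ->
  (forall w (i : 'I_#|S|) j, X w (enum_val i) j = (diag_mx sigma *m Phi w) i j) ->
  (forall l : 'I_N, l \notin S ->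
     vnorm2 (pinvS (colsS A S) *m col l A)
       < A_L R L / (3 * Num.sqrt L%:R + 2 * Num.sqrt #|S|%:R)) ->
  exists E : set T, [/\ measurable E,
    E `<=` [set w | unique_l21_solution A (map_mx (real_complex R) (X w))] &
    ((1 - expR (- (L%:R / 8)) - #|S|%:R * expR (- (A_L R L ^+ 2 / 8)))%:E <= P E)%E].
Proof.
move=> L0 rA sigma0 iid X0 XE gammaA.
(* Used twice: to relax the condition on the columns of [A] to one in [Num.sqrt L%:R], and to bound
   [expR (- (L%:R / 8))] by [expR (- (A_L R L ^+ 2 / 8))]. *)
have AL2 := A_L_sqr_le R L L0.
have [G [mG PG opG]] := gaussian_operator_norm_tail R d T P _ L Phi iid L0.
pose E i := [set w | 4 / 9 * L%:R <= \sum_j Phi w i j ^+ 2].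
have mE i : measurable (E i) := (row_norm_tail R d T P _ L Phi i iid).1.
have PE i : (P (~` E i) <= (expR (- (L%:R / 8)))%:E)%E :=
  (row_norm_tail R d T P _ L Phi i iid).2.
(* The bad event: the operator bound or one of the row bounds fails. *)
pose B := ~` G `|` \big[setU/set0]_(i < #|S|) ~` E i.
have mU : measurable (\big[setU/set0]_(i < #|S|) ~` E i).
  by apply: bigsetU_measurable => i _; exact: measurableC.
have mB : measurable B by apply: measurableU => //; exact: measurableC.
exists (~` B); split; first exact: measurableC.
- rewrite /B setCU setCK => w [/= Gw nE].
  apply: (unique_solution_of_bounds R n N L A S sigma (Phi w) (X w)) => //.
  + by move=> r j; exact: X0.
  + move=> l lS; apply: (lt_le_trans (gammaA l lS)).
    rewrite ler_wpM2r ?invr_ge0 ?addr_ge0 ?mulr_ge0 ?sqrtr_ge0//.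
    by rewrite (le_trans (ler_norm _))// -sqrtr_sqr ler_wsqrtr.
  + move=> i; apply: contrapT => nEi; apply: nE.
    by rewrite (bigD1 i)//=; left.
  + exact: opG.
have PB : (P B <= (expR (- (L%:R / 8)) + #|S|%:R * expR (- (L%:R / 8)))%:E)%E.
  apply: (le_trans (measureU2 _ _ _)) => //; first exact: measurableC.
  rewrite EFinD; apply: leeD => //.
  apply: le_trans (measure_bigsetU_le R d T P _ _ _ _) _.
    by move=> i; exact: measurableC.
  apply: (@le_trans _ _ (\sum_(i < #|S|) (expR (- (L%:R / 8)))%:E)%E).
    by apply: lee_sum => i _; exact: PE.
  by rewrite sumEFin sumr_const card_ord [X in (_ <= X%:E)%E]mulr_natl.
rewrite probability_setC//.
apply: (@le_trans _ _ (1 - (expR (- (L%:R / 8)) + #|S|%:R * expR (- (L%:R / 8)))%:E)%E).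
  rewrite -EFinB lee_fin opprD addrA lerD2l lerN2 ler_wpM2l//.
  by rewrite ler_expR lerN2 ler_pM2r.
by rewrite leeD2l// leeN2.
Qed.
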